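(* Let $T>0$, $d\ge1$, $1<p<\infty$, and let $F,F_1,F_2\in BV_p(Conv(R^d))$ be Hukuhara differentiable set-valued functions on $[0,T]$ with $p$-integrably bounded Hukuhara derivatives. Let $g\in\mathcal{C}^\alpha(R^1)$, where $\alpha\in(0,1]$ and $1/p+\alpha>1$. Then, for every $t\in[0,T]$, $$(\mathcal{IS})\int_0^t(F_1+F_2)\,dg=(\mathcal{IS})\int_0^tF_1\,dg+(\mathcal{IS})\int_0^tF_2\,dg .$$ Moreover, if the set $F(0)$ is bounded in $R^d$, then $(\mathcal{IS})\int_0^{\cdot}F\,dg$ and $(\mathcal{IS})\int_s^tF\,dg$ (for $0\le s\le t\le T$) are bounded sets in $\mathcal{C}^\alpha(R^d)$ and in $R^d$, respectively.
   Context: $R^d$ carries the Euclidean norm $\|\cdot\|$. $Conv(R^d)$ is the family of nonempty compact convex subsets of $R^d$ with the Hausdorff metric $H_{R^d}$; sums of sets are Minkowski sums, and $(F_1+F_2)(t)=F_1(t)+F_2(t)$. For a function $f$ from $[0,T]$ into a metric space $(E,\rho)$, the Riesz $p$-variation is $V_p(f)=\sup\sum_{i=1}^n\frac{\rho(f(t_{i-1}),f(t_i))^p}{(t_i-t_{i-1})^{p-1}}$, the supremum being over all partitions $0=t_0<\dots<t_n=T$. $BV_p(R^d)$ and $BV_p(Conv(R^d))$ are the classes of functions $[0,T]\to R^d$, respectively $[0,T]\to(Conv(R^d),H_{R^d})$, with finite $V_p$. $\mathcal{C}^\alpha(R^m)$ is the Banach space of $f:[0,T]\to R^m$ with finite norm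 $\|f\|_\alpha=\sup_{t}\|f(t)\|+\sup_{0\le s<t\le T}\frac{\|f(t)-f(s)\|}{(t-s)^\alpha}$. For $A,B\in Conv(R^d)$, the Hukuhara difference $A\div B$ is the set $C\in Conv(R^d)$ with $A=B+C$, if it exists. $G:[0,T]\to Conv(R^d)$ is Hukuhara differentiable at $t_0$ if there is $D_H(G)(t_0)\in Conv(R^d)$ such that the limits $\lim_{\Delta t\to0+}\frac{G(t_0+\Delta t)\div G(t_0)}{\Delta t}$ and $\lim_{\Delta t\to0+}\frac{G(t_0)\div G(t_0-\Delta t)}{\Delta t}$ exist and both equal $D_H(G)(t_0)$; it is Hukuhara differentiable if this holds at every point of $[0,T]$ (only the one-sided limit that makes sense being required at the endpoints). A set-valued $\Phi$ is $p$-integrably bounded if there is $h\in L^p([0,T])$ with $\sup_{a\in\Phi(t)}\|a\|\le h(t)$ for a.e. $t$. $S_{V_p}(F)=\{f\in BV_p(R^d): f(t)\in F(t),\ t\in[0,T]\}$; $S_{L^p}(\Phi)=\{\phi\in L^p([0,T],R^d):\phi(t)\in\Phi(t)\text{ for a.e. }t\}$; $\mathcal{IS}(F)=\{f\in BV_p(R^d): f\in S_{V_p}(F),\ f'\in S_{L^p}(D_H(F))\}$, where $f'$ is the a.e. derivative. The set-valued Young integral is $(\mathcal{IS})\int_0^tF\,dg=\overline{\{\int_0^tf\,dg: f\in\mathcal{IS}(F)\}}$ (closure in $R^d$), where $\int_0^tf\,dg$ is the Young integral, i.e. the limit of the Riemann sums $\sum_i f(t_{i-1})(g(t_i)-g(t_{i-1}))$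 over partitions of $[0,t]$ as the mesh tends to $0$. Likewise $(\mathcal{IS})\int_s^tF\,dg=\overline{\{\int_s^tf\,dg: f\in\mathcal{IS}(F)\}}$, and $(\mathcal{IS})\int_0^{\cdot}F\,dg$ denotes the set of functions $\{\int_0^{\cdot}f\,dg: f\in\mathcal{IS}(F)\}$. *)

(* Defs.v *)
(* Functions on [0, T] are total functions on R; every notion below reads only
   their values on [0, T].  'rV[R]_d carries the sup norm in the library: the
   library's topology (compact, closure, lim, is_derive) and bounded_set are
   those of the Euclidean norm, while every quantitative notion below uses
   the Euclidean norm enorm. *)
From HB Require Import structures.
From mathcomp Require Import all_boot all_order all_algebra.
From mathcomp Require Import all_classical all_reals all_analysis.

Set Implicit Arguments.
Unset Strict Implicit.
Unset Printing Implicit Defensive.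

Import Order.TTheory GRing.Theory Num.Theory.
Import numFieldNormedType.Exports.

Local Open Scope classical_set_scope.
Local Open Scope ring_scope.

Section Euclidean.
Context (R : realType) (d : nat).
Implicit Types (x y : 'rV[R]_d) (A B C : set 'rV[R]_d).

Definition enorm x : R := Num.sqrt (\sum_(i < d) x ord0 i ^+ 2).

Definition eucl_dist x y : R := enorm (x - y).

Definition Conv : set (set 'rV[R]_d) :=
  [set A : set 'rV[R]_d |
    [/\ A !=set0, compact A & @convex_set R 'rV[R]_d A]].

Definition minkowski_sum A B : set 'rV[R]_d :=
  [set x + y | x in A & y in B].

Definition scale_set (c : R) A : set 'rV[R]_d := [set c *: x | x in A].

(* The real-valued inf and sup below are the intended ones only on nonempty
   bounded sets, in particular on Conv. *)
Definition dist_to_set x B : R := inf [set eucl_dist x y | y in B].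

Definition hausdorff_dist A B : R :=
  Num.max (sup [set dist_to_set x B | x in A])
          (sup [set dist_to_set y A | y in B]).

(* C is the Hukuhara difference of A and B. *)
Definition is_hukuhara_diff A B C := Conv C /\ A = minkowski_sum B C.

End Euclidean.

(* V_p(f) on [0, T] for f with values in E equipped with the distance rho; a
   partition 0 = t_0 < ... < t_n = T is encoded by s = [:: t_1; ...; t_n]. *)
Definition riesz_sum (R : realType) (E : Type) (rho : E -> E -> R)
    (p T : R) (f : R -> E) (s : seq R) : R :=
  let t := nth T (0 :: s) in
  \sum_(0 <= n < size s)
    rho (f (t n)) (f (t n.+1)) `^ p / (t n.+1 - t n) `^ (p - 1).

Definition riesz_variation (R : realType) (E : Type) (rho : E -> E -> R)
    (p T : R) (f : R -> E) : \bar R :=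
  ereal_sup [set (riesz_sum rho p T f s)%:E | s in itv_partition 0 T].

Section FunctionClasses.
Context (R : realType) (d : nat).
Variables (p T : R).

Definition BVp : set (R -> 'rV[R]_d) :=
  [set f | (riesz_variation (@eucl_dist R d) p T f < +oo)%E].

Definition BVp_Conv : set (R -> set 'rV[R]_d) :=
  [set F | (forall t, t \in `[0, T] -> Conv (F t)) /\
           (riesz_variation (@hausdorff_dist R d) p T F < +oo)%E].

(* Restriction by 0 outside [0, T].  Measurability is Borel, which gives the same
   L^p classes: a Lebesgue measurable function is a.e. equal to a Borel one. *)
Definition Lp_itv : set (R -> R) :=
  [set h | (h \_ `[0, T]) \in Lfun (@lebesgue_measure R) p%:E].

Definition Lp_itv_vec : set (R -> 'rV[R]_d) :=
  [set phi : R -> 'rV[R]_d |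
    (forall i, measurable_fun `[0, T] (fun t => phi t ord0 i)) /\
    Lp_itv (fun t => enorm (phi t))].

Definition p_integrably_bounded (Phi : R -> set 'rV[R]_d) :=
  exists2 h, Lp_itv h &
    {ae @lebesgue_measure R, forall t, t \in `[0, T] ->
      (ereal_sup [set (enorm a)%:E | a in Phi t] <= (h t)%:E)%E}.

End FunctionClasses.

(* Norm of C^alpha, infinite outside that space; nrm is the norm of V. *)
Definition holder_norm (R : realType) (V : zmodType) (nrm : V -> R)
    (alpha T : R) (f : R -> V) : \bar R :=
  (ereal_sup [set (nrm (f t))%:E | t in `[0%R, T]] +
   ereal_sup [set (nrm (f st.2 - f st.1) / (st.2 - st.1) `^ alpha)%R%:E
             | st in [set st : R * R | (0 <= st.1 < st.2)%R /\
                                       (st.2 <= T)%R]])%E.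

Definition holder_bounded (R : realType) (V : zmodType) (nrm : V -> R)
    (alpha T : R) (K : set (R -> V)) :=
  exists M : R, forall f, K f -> (holder_norm nrm alpha T f <= M%:E)%E.

Section Hukuhara.
Context (R : realType) (d : nat).
Implicit Types (G : R -> set 'rV[R]_d) (D : set 'rV[R]_d).

(* The limits are taken in (Conv, hausdorff_dist); their existence includes
   that of the differences for all small increments. *)
Definition is_hukuhara_derivative (T : R) G (t0 : R) D :=
  [/\ Conv D,
      t0 < T -> forall e : R, 0 < e -> \forall h \near 0^'+,
        exists2 C, is_hukuhara_diff (G (t0 + h)) (G t0) C &
                   hausdorff_dist (scale_set h^-1 C) D < e
    & 0 < t0 -> forall e : R, 0 < e -> \forall h \near 0^'+,
        exists2 C, is_hukuhara_diff (G t0) (G (t0 - h)) C &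
                   hausdorff_dist (scale_set h^-1 C) D < e].

Definition hukuhara_differentiable (T : R) G :=
  forall t, t \in `[0, T] -> exists D, is_hukuhara_derivative T G t D.

Definition D_H (T : R) G : R -> set 'rV[R]_d :=
  fun t => xget set0 (is_hukuhara_derivative T G t).

End Hukuhara.

Section YoungIntegral.
Context (R : realType) (d : nat).
Implicit Types (f : R -> 'rV[R]_d) (g : R -> R).

Definition mesh (a b : R) (s : seq R) : R :=
  let t := nth b (a :: s) in
  \big[Num.max/0]_(0 <= n < size s) (t n.+1 - t n).

(* The filter of partitions of [a, b] with mesh tending to 0. *)
Definition mesh_to0 (a b : R) : set_system (seq R) :=
  filter_from [set delta : R | 0 < delta]
    (fun delta => [set s | itv_partition a b s /\ mesh a b s < delta]).

Definition riemann_sum f g (a b : R) (s : seq R) : 'rV[R]_d :=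
  let t := nth b (a :: s) in
  \sum_(0 <= n < size s) (g (t n.+1) - g (t n)) *: f (t n).

Definition young_integral f g (a b : R) : 'rV[R]_d :=
  lim (riemann_sum f g a b @ mesh_to0 a b).

End YoungIntegral.

Section SetValuedIntegral.
Context (R : realType) (d : nat).
Variables (p T : R).
Implicit Types (F : R -> set 'rV[R]_d) (g : R -> R).

Definition S_Vp F : set (R -> 'rV[R]_d) :=
  [set f | BVp p T f /\ forall t, t \in `[0, T] -> F t (f t)].

Definition S_Lp (Phi : R -> set 'rV[R]_d) : set (R -> 'rV[R]_d) :=
  [set phi | Lp_itv_vec p T phi /\
    {ae @lebesgue_measure R, forall t, t \in `[0, T] -> Phi t (phi t)}].

(* phi is the a.e. derivative f' of f, as an element of L^p; the two-sided
   derivative at 0 and T is irrelevant, {0, T} being negligible. *)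
Definition IS F : set (R -> 'rV[R]_d) :=
  [set f | S_Vp F f /\
    exists2 phi, S_Lp (D_H T F) phi &
      {ae @lebesgue_measure R, forall t : R, t \in `[0, T] ->
        is_derive t 1 f (phi t)}].

Definition IS_integral F g (s t : R) : set 'rV[R]_d :=
  closure [set young_integral f g s t | f in IS F].

Definition IS_integral_fun F g : set (R -> 'rV[R]_d) :=
  [set (fun t => young_integral f g 0 t) | f in IS F].

End SetValuedIntegral.

(* Main.v *)
Require Import Defs.
From HB Require Import structures.
From mathcomp Require Import all_boot all_order all_algebra.
From mathcomp Require Import all_classical all_reals all_analysis.
From mathcomp Require Import measurable_realfun ring lra.

Set Implicit Arguments.
Unset Strict Implicit.
Unset Printing Implicit Defensive.

Import Order.TTheory GRing.Theory Num.Theory.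
Import numFieldNormedType.Exports.

Local Open Scope classical_set_scope.
Local Open Scope ring_scope.

(* A set A in Conv(R^d) is encoded by its support function supp A u = max <a, u>,
   which is additive in A and Lipschitz for the Hausdorff distance.  Hence Hukuhara
   differentiability of F makes t |-> supp (F t) u differentiable with derivative
   supp (D_H F t) u, and finite Riesz p-variation makes it absolutely continuous.
   If f is absolutely continuous with f(0) in F(0) and f' in D_H F a.e., then
   supp (F t) u - <f t, u> is nondecreasing, so f is a selection of F, and its
   increments are bounded by the Hausdorff distances of the values of F, so f is
   in IS(F).  Given f in IS(F1 + F2), a measurable selection theorem writes f' as
   the sum of measurable selections of D_H F1 and D_H F2, whose primitives
   decompose f; thus IS(F1 + F2) = IS(F1) + IS(F2).
   Since f is the primitive of f', summation by parts shows that the Riemann sums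
   of f dg converge, with a limit bounded by C |t - s|^alpha uniformly in f. *)

(** * Support functions *)

Section EuclideanSpace.
Context (R : realType) (d : nat).
Implicit Types (x y z u v : 'rV[R]_d) (a b c : R) (A B C D : set 'rV[R]_d).

(** Only one inclusion of the sum formula is substantial: an f in IS(F1 + F2) has to be split, and a
    pointwise choice of f1(t) in F1(t) controls neither its variation nor its derivative. Hence f'
    is split instead of f, and [IS_intro] recovers the values of the summands from their derivatives
    and from membership at time 0 alone. Two obstacles shape the rest. A function whose derivative
    is a.e. nonnegative may still decrease (minus the Cantor function), so every function to be
    compared carries a [controlled] bound, a property stable under sums and shared by functions of
    finite Riesz variation and by primitives of Lp functions. And [D_H F] comes with no
    measurability; yet its support function in a fixed direction is a pointwise limit of difference
    quotients, and countably many directions determine a compact convex set. Finally the integrals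
    are closures, so that additivity rests on the boundedness estimate as well: a sum of closed sets
    is closed once they are compact. *)

Definition dot x y : R := \sum_(i < d) x ord0 i * y ord0 i.

Lemma dotC x y : dot x y = dot y x.
Proof. by apply: eq_bigr => i _; rewrite mulrC. Qed.

Lemma dotDl x y z : dot (x + y) z = dot x z + dot y z.
Proof. by rewrite -big_split; apply: eq_bigr => i _; rewrite mxE mulrDl. Qed.

Lemma dotZl a x y : dot (a *: x) y = a * dot x y.
Proof. by rewrite mulr_sumr; apply: eq_bigr => i _; rewrite mxE mulrA. Qed.

Lemma dotNl x y : dot (- x) y = - dot x y.
Proof. by rewrite -scaleN1r dotZl mulN1r. Qed.

Lemma dotBl x y z : dot (x - y) z = dot x z - dot y z.
Proof. by rewrite dotDl dotNl. Qed.

Lemma dotDr x y z : dot x (y + z) = dot x y + dot x z.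
Proof. by rewrite dotC dotDl !(dotC x). Qed.

Lemma dotZr a x y : dot x (a *: y) = a * dot x y.
Proof. by rewrite dotC dotZl dotC. Qed.

Lemma dotNr x y : dot x (- y) = - dot x y.
Proof. by rewrite dotC dotNl dotC. Qed.

Lemma dotBr x y z : dot x (y - z) = dot x y - dot x z.
Proof. by rewrite dotDr dotNr. Qed.

Lemma dot0l x : dot 0 x = 0.
Proof. by rewrite -(scale0r 0) dotZl mul0r. Qed.

Lemma dot_delta x i : dot x (delta_mx ord0 i) = x ord0 i.
Proof.
rewrite /dot (bigD1 i)//= mxE !eqxx mulr1 big1 ?addr0// => j ji.
by rewrite mxE (negbTE ji) andbF mulr0.
Qed.

Lemma dot_ge0 x : 0 <= dot x x.
Proof. by apply: sumr_ge0 => i _; rewrite -expr2 sqr_ge0. Qed.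

Lemma enormE x : enorm x = Num.sqrt (dot x x).
Proof. by []. Qed.

Lemma sqr_enorm x : enorm x ^+ 2 = dot x x.
Proof. by rewrite enormE sqr_sqrtr ?dot_ge0. Qed.

Lemma enorm_ge0 x : 0 <= enorm x.
Proof. exact: sqrtr_ge0. Qed.
Hint Resolve enorm_ge0 : core.

Lemma coord_le_enorm x i : `|x ord0 i| <= enorm x.
Proof.
rewrite -sqrtr_sqr enormE ler_wsqrtr//.
rewrite /dot (bigD1 i)//= -expr2 lerDl sumr_ge0// => j _.
by rewrite -expr2 sqr_ge0.
Qed.

Lemma enorm_eq0 x : enorm x = 0 -> x = 0.
Proof.
move=> x0; apply/rowP => i; rewrite mxE; apply/eqP.
by rewrite -normr_le0 -x0 coord_le_enorm.
Qed.

Lemma dot_le x y : dot x y <= enorm x * enorm y.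
Proof.
have [y0|y0] := eqVneq (enorm y) 0.
  by rewrite y0 mulr0 (enorm_eq0 y0) dotC dot0l.
have {}y0 : 0 < enorm y by rewrite lt_neqAle eq_sym y0 enorm_ge0.
(* This vector is [enorm y ^+ 2] times the component of [x] orthogonal to [y]; its squared norm is
   [enorm y ^+ 2] times the Cauchy-Schwarz defect. *)
have := dot_ge0 (enorm y ^+ 2 *: x - dot x y *: y).
rewrite !(dotBl, dotBr, dotZl, dotZr) (dotC y x) -!sqr_enorm => H.
have {}H : 0 <= enorm y ^+ 2 * ((enorm x * enorm y) ^+ 2 - dot x y ^+ 2).
  by move: H; congr (0 <= _); ring.
rewrite pmulr_rge0 ?exprn_gt0// subr_ge0 in H.
rewrite (le_trans (ler_norm _))// -ler_sqr ?nnegrE ?mulr_ge0//.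
by rewrite -normrX ger0_norm ?sqr_ge0.
Qed.

Lemma enormD x y : enorm (x + y) <= enorm x + enorm y.
Proof.
rewrite -ler_sqr ?nnegrE ?addr_ge0// sqr_enorm !(dotDl, dotDr) -!sqr_enorm.
by have := dot_le x y; rewrite (dotC y x); nra.
Qed.

Lemma enormZ a x : enorm (a *: x) = `|a| * enorm x.
Proof.
by rewrite enormE dotZl dotZr mulrA -expr2 sqrtrM ?sqr_ge0// sqrtr_sqr.
Qed.

Lemma enormN x : enorm (- x) = enorm x.
Proof. by rewrite -scaleN1r enormZ normrN1 mul1r. Qed.

Lemma enormB x y : enorm (x - y) = enorm (y - x).
Proof. by rewrite -enormN opprB. Qed.

Lemma ler_enormB x y : enorm (x - y) <= enorm x + enorm y.
Proof. by rewrite -(enormN y) enormD. Qed.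

Lemma norm_dot_le x y : `|dot x y| <= enorm x * enorm y.
Proof.
by rewrite ler_norml dot_le andbT lerNl -dotNl (le_trans (dot_le _ _))// enormN.
Qed.

Lemma enorm_le_sum x : enorm x <= \sum_(i < d) `|x ord0 i|.
Proof.
rewrite -ler_sqr ?nnegrE ?sumr_ge0// sqr_enorm expr2 mulr_sumr.
apply: ler_sum => i _.
rewrite (le_trans (ler_norm _))// normrM ler_wpM2r//.
by rewrite (bigD1 i)//= lerDl sumr_ge0.
Qed.

Lemma coord_le_norm x i : `|x ord0 i| <= `|x|.
Proof.
rewrite [leRHS]/Num.norm /= mx_normrE.
by apply/bigmax_geP; right => /=; exists (ord0, i).
Qed.

Lemma enorm_le_norm x : enorm x <= d%:R * `|x|.
Proof.
rewrite (le_trans (enorm_le_sum _))//.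
rewrite -[X in X%:R]card_ord mulr_natl -sumr_const ler_sum// => i _.
exact: coord_le_norm.
Qed.

Lemma norm_le_enorm x : `|x| <= enorm x.
Proof.
rewrite {1}/Num.norm /= mx_normrE; apply/bigmax_leP; split => // -[i j] _ /=.
by rewrite ord1 coord_le_enorm.
Qed.

Lemma lipschitz_continuous (f : 'rV[R]_d -> R) k :
  (forall x y, `|f x - f y| <= k * enorm (x - y)) -> continuous f.
Proof.
move=> fk x; apply: (proj2 (@cvgrPdist_le R R^o _ (nbhs x) _ f (f x))) => e e0.
(* The factor in [d] passes from the Euclidean norm to the sup norm of the topology; the added ones
   keep [c] positive for every [k] and [d]. *)
pose c := (`|k| + 1) * (d%:R + 1).
have c0 : 0 < c by rewrite mulr_gt0// ltr_wpDl.
apply/(@nbhs_ballP R 'rV[R]_d); exists (e / c); first by rewrite /= divr_gt0.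
move=> y; rewrite -ball_normE /= => /ltW xy; rewrite (le_trans (fk _ _))//.
apply: (@le_trans _ _ (c * `|x - y|)); last by rewrite mulrC -ler_pdivlMr.
have := enorm_le_norm (x - y); have := ler_norm k.
have := normr_ge0 (x - y); have := enorm_ge0 (x - y); rewrite /c.
set A := enorm _; set B := `|x - y| => ? ? ? H.
have : k * A <= (`|k| + 1) * A by rewrite ler_wpM2r// ler_wpDr.
have : (`|k| + 1) * A <= (`|k| + 1) * ((d%:R + 1) * B).
  by rewrite ler_wpM2l ?addr_ge0// mulrDl mul1r ler_wpDr.
by rewrite -mulrA => H2 H1; exact: le_trans H1 H2.
Qed.

Lemma ler_dist_enorm x y : `|enorm x - enorm y| <= enorm (x - y).
Proof.
have := enormD (x - y) y; have := enormD (y - x) x.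
by rewrite !subrK ler_norml (enormB y x) => ? ?; apply/andP; split; lra.
Qed.

Lemma continuous_enorm : continuous (@enorm R d).
Proof.
by apply: (@lipschitz_continuous _ 1) => x y; rewrite mul1r ler_dist_enorm.
Qed.

Lemma continuous_dot u : continuous (dot^~ u).
Proof.
apply: (@lipschitz_continuous _ (enorm u)) => x y.
by rewrite -dotBl mulrC norm_dot_le.
Qed.

Lemma Conv_bounded A : Conv A -> exists2 M, 0 <= M & forall x, A x -> enorm x <= M.
Proof.
case=> _ /compact_bounded [M [_ AM]] _.
exists (d%:R * (`|M| + 1)); first by rewrite mulr_ge0// addr_ge0.
move=> x Ax; rewrite (le_trans (enorm_le_norm _))// ler_wpM2l//.
by apply: AM => //; rewrite (le_lt_trans (ler_norm _))// ltrDl.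
Qed.

Lemma Conv_conv A x y a : Conv A -> 0 <= a <= 1 -> A x -> A y ->
  A (a *: x + (1 - a) *: y).
Proof.
case=> _ _ cA /andP[a0 a1] Ax Ay.
have a01 : Itv.spec (@Itv.num_sem R) (Itv.Real `[0%Z, 1%Z]%O) a.
  by rewrite /= /Itv.num_sem /= in_itv /= a0 a1 ger0_real.
have := cA x y (Itv.mk a01); rewrite !inE => /(_ Ax Ay).
by [].
Qed.

Definition supp A u : R := sup [set dot x u | x in A].

Lemma supp_has_sup A u : Conv A -> has_sup [set dot x u | x in A].
Proof.
move=> cA; split; first by case: (cA) => -[x Ax] _ _; exists (dot x u), x.
have [M M0 AM] := Conv_bounded cA; exists (M * enorm u) => _ [x Ax <-].
by rewrite (le_trans (dot_le _ _))// ler_wpM2r// AM.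
Qed.

Lemma supp_ge A x u : Conv A -> A x -> dot x u <= supp A u.
Proof. by move=> cA Ax; apply: sup_ubound; [exact: (supp_has_sup u cA).2|exists x]. Qed.

Lemma supp_le A u a : Conv A -> (forall x, A x -> dot x u <= a) -> supp A u <= a.
Proof.
move=> cA Aa; apply: ge_sup; first exact: (supp_has_sup u cA).1.
by move=> _ [x Ax <-]; exact: Aa.
Qed.

(** Lipschitz dependence on the direction: an inequality known on a dense set of directions passes
    to all of them. *)
Lemma supp_leD A M x u : Conv A -> (forall x, A x -> enorm x <= M) ->
  supp A (x + u) <= supp A x + M * enorm u.
Proof.
move=> cA AM; apply: supp_le => // y Ay; rewrite dotDr lerD// ?supp_ge//.
by rewrite (le_trans (dot_le _ _))// ler_wpM2r// AM.
Qed.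

Lemma suppZ A a u : Conv A -> 0 <= a -> supp A (a *: u) = a * supp A u.
Proof.
move=> cA; rewrite le_eqVlt => /predU1P[<-|a0].
  rewrite mul0r scale0r; apply/eqP; rewrite eq_le; apply/andP; split.
    by apply: supp_le => // x _; rewrite dotC dot0l.
  by case: (cA) => -[x Ax] _ _; rewrite -(dot0l x) dotC supp_ge.
apply/eqP; rewrite eq_le; apply/andP; split.
  by apply: supp_le => // x Ax; rewrite dotZr ler_pM2l// supp_ge.
rewrite -ler_pdivlMl//; apply: supp_le => // x Ax.
by rewrite ler_pdivlMl// -dotZr supp_ge.
Qed.

(* Separation by the point p of A nearest to x, along the normal x - p. *)
Lemma supp_separation A x : Conv A -> (forall u, dot x u <= supp A u) -> A x.
Proof.
move=> cA xA; case: (cA) => A0 kA _.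
have cf : continuous (fun y => enorm (y - x)).
  apply: (@lipschitz_continuous _ 1) => y z.
  by rewrite mul1r (le_trans (ler_dist_enorm _ _))// opprB addrA subrK.
have [p] := EVT_min_rV A0 kA (continuous_subspaceT cf).
rewrite inE => Ap min_p.
have obtuse y : A y -> dot (y - p) (x - p) <= 0.
  move=> Ay; rewrite leNgt; apply/negP => pos.
  pose s := dot (y - p) (x - p); pose n := enorm (y - p) ^+ 2.
  have n0 : 0 <= n by rewrite exprn_ge0.
  (* Moving from [p] toward [y] by the fraction [l] lowers the squared distance to [x] by
     [l * (2 * s - l * n)], which is positive as soon as [l * n < s]; this [l] is also at most 1. *)
  pose l := s / (s + n).
  have sn : 0 < s + n by rewrite ltr_wpDr.
  have l01 : 0 <= l <= 1.
    by rewrite /l divr_ge0 ?(ltW pos) ?(ltW sn)//= ler_pdivrMr// mul1r lerDl.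
  have := min_p (l *: y + (1 - l) *: p).
  rewrite inE => /(_ (Conv_conv cA l01 Ay Ap)).
  rewrite -ler_sqr ?nnegrE// !sqr_enorm.
  have -> : l *: y + (1 - l) *: p - x = l *: (y - p) - (x - p).
    by apply/rowP => i; rewrite !mxE; ring.
  have -> : dot (p - x) (p - x) = dot (x - p) (x - p).
    by rewrite -(opprB x p) dotNl dotNr opprK.
  have l0 : 0 < l by rewrite divr_gt0.
  have ln : l * n < s.
    by rewrite /l mulrAC ltr_pdivrMr// mulrDr ltrDr mulr_gt0.
  rewrite /n sqr_enorm in ln; move: pos ln; rewrite /s.
  move: (y - p) (x - p) => v w pos ln.
  rewrite !(dotBl, dotBr) !dotZl !dotZr (dotC w v).
  have : l * (l * dot v v) < l * dot v w by rewrite ltr_pM2l.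
  by have : 0 < l * dot v w; [rewrite mulr_gt0|lra].
have := xA (x - p); rewrite leNgt => /negP.
have [xp|xp] := eqVneq (enorm (x - p)) 0.
  by move: (enorm_eq0 xp) => /eqP; rewrite subr_eq0 => /eqP ->.
case; apply: (@le_lt_trans _ _ (dot p (x - p))).
  by apply: supp_le => // y /obtuse; rewrite dotBl subr_le0.
rewrite -subr_gt0 -dotBl -sqr_enorm exprn_gt0// lt_neqAle eq_sym xp.
by rewrite enorm_ge0.
Qed.

Lemma Conv_eq_supp A B : Conv A -> Conv B ->
  (forall u, supp A u = supp B u) -> A = B.
Proof.
move=> cA cB AB; apply/seteqP; split => x xin; apply: supp_separation => // u.
  by rewrite -AB supp_ge.
by rewrite AB supp_ge.
Qed.

End EuclideanSpace.
(** * Hausdorff distance and Hukuhara derivative *)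

Section Hausdorff.
Context (R : realType) (d : nat).
Implicit Types (x y z u v : 'rV[R]_d) (a b c : R) (A B C D : set 'rV[R]_d).

Lemma Conv_minkowski A B : Conv A -> Conv B -> Conv (minkowski_sum A B).
Proof.
move=> cA cB; case: (cA) (cB) => -[x Ax] kA _ [[y By] kB _]; split.
- by exists (x + y), x => //; exists y.
- rewrite (_ : minkowski_sum A B =
      (fun z : 'rV[R]_d * 'rV[R]_d => z.1 + z.2) @` (A `*` B)).
    apply: continuous_compact; last exact: compact_setX.
    by apply: continuous_subspaceT => z; exact: add_continuous.
  apply/seteqP; split=> [_ [u Au [v Bv <-]]|_ [[u v] /= [Au Bv] <-]].
    by exists (u, v).
  by exists u => //; exists v.
- move=> _ _ l /set_mem[u1 Au1 [v1 Bv1 <-]] /set_mem[u2 Au2 [v2 Bv2 <-]].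
  apply/mem_set.
  have l01 : 0 <= l%:num <= 1 by rewrite ge0 le1.
  exists (l%:num *: u1 + (1 - l%:num) *: u2); first exact: Conv_conv.
  exists (l%:num *: v1 + (1 - l%:num) *: v2); first exact: Conv_conv.
  by rewrite addrACA -!scalerDr.
Qed.

Lemma Conv_scale a A : Conv A -> Conv (scale_set a A).
Proof.
move=> cA; case: (cA) => -[x Ax] kA _; split.
- by exists (a *: x), x.
- apply: continuous_compact => //.
  by apply: continuous_subspaceT => z; exact: scaler_continuous.
- move=> _ _ l /set_mem[u Au <-] /set_mem[v Av <-]; apply/mem_set.
  have l01 : 0 <= l%:num <= 1 by rewrite ge0 le1.
  exists (l%:num *: u + (1 - l%:num) *: v); first exact: Conv_conv.
  by rewrite scalerDr !scalerA (mulrC a) (mulrC a) -!scalerA.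
Qed.

Lemma supp_minkowski A B u : Conv A -> Conv B ->
  supp (minkowski_sum A B) u = supp A u + supp B u.
Proof.
move=> cA cB; have cAB := Conv_minkowski cA cB.
apply/eqP; rewrite eq_le; apply/andP; split.
  by apply: supp_le => // _ [x Ax [y By <-]]; rewrite dotDl lerD// supp_ge.
rewrite -lerBrDr; apply: supp_le => // x Ax.
rewrite lerBrDr -lerBrDl; apply: supp_le => // y By.
by rewrite lerBrDl -dotDl supp_ge//; exists x => //; exists y.
Qed.

Lemma supp_scale A u a : Conv A -> 0 <= a -> supp (scale_set a A) u = a * supp A u.
Proof.
move=> cA a0; rewrite -suppZ//; congr sup; apply/seteqP; split.
  by move=> _ [_ [x Ax <-] <-]; exists x => //; rewrite dotZl dotZr.
by move=> _ [x Ax <-]; exists (a *: x); [exists x|rewrite dotZl dotZr].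
Qed.

Lemma dist_to_set_has_inf x B : B !=set0 -> has_inf [set eucl_dist x y | y in B].
Proof.
move=> [y By]; split; first by exists (eucl_dist x y), y.
by exists 0 => _ [z _ <-]; exact: enorm_ge0.
Qed.

Lemma dist_to_set_near x B (e : R) : B !=set0 -> 0 < e ->
  exists2 y, B y & enorm (x - y) <= dist_to_set x B + e.
Proof.
move=> B0 e0; have [_ [y By <-] ye] := inf_adherent e0 (dist_to_set_has_inf x B0).
by exists y => //; exact: ltW.
Qed.

Lemma dist_to_set_le x y B : B y -> dist_to_set x B <= enorm (x - y).
Proof.
move=> By; apply: ge_inf; first by exists 0 => _ [z _ <-]; exact: enorm_ge0.
by exists y.
Qed.

Lemma dist_to_set_has_sup A B : Conv A -> Conv B ->
  has_sup [set dist_to_set x B | x in A].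
Proof.
move=> cA [[y By] _ _]; case: (cA) => -[x Ax] _ _.
split; first by exists (dist_to_set x B), x.
have [M M0 AM] := Conv_bounded cA.
exists (M + enorm y) => _ [z Az <-]; rewrite (le_trans (dist_to_set_le z By))//.
by rewrite (le_trans (ler_enormB _ _))// lerD2r AM.
Qed.

Lemma hausdorffC A B : hausdorff_dist A B = hausdorff_dist B A.
Proof. by rewrite /hausdorff_dist maxC. Qed.

(** With [hausdorff_le], this is the neighbourhood description through which the distance is used;
    the slack [e] avoids having to attain the infimum. *)
Lemma hausdorff_near A B x (e : R) : Conv A -> Conv B -> A x -> 0 < e ->
  exists2 y, B y & enorm (x - y) <= hausdorff_dist A B + e.
Proof.
move=> cA cB Ax e0; have [|y By xy] := dist_to_set_near x _ e0 (B := B).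
  by case: cB.
exists y => //; rewrite (le_trans xy)// lerD2r /hausdorff_dist le_max.
apply/orP; left; apply: sup_ubound; first exact: (dist_to_set_has_sup cA cB).2.
by exists x.
Qed.

Lemma hausdorff_le A B a : Conv A -> Conv B ->
  (forall x, A x -> exists2 y, B y & enorm (x - y) <= a) ->
  (forall x, B x -> exists2 y, A y & enorm (x - y) <= a) ->
  hausdorff_dist A B <= a.
Proof.
move=> cA cB AB BA; rewrite /hausdorff_dist ge_max; apply/andP; split.
  apply: ge_sup; first exact: (dist_to_set_has_sup cA cB).1.
  by move=> _ [x /AB[y By xy] <-]; exact: le_trans (dist_to_set_le x By) xy.
apply: ge_sup; first exact: (dist_to_set_has_sup cB cA).1.
by move=> _ [x /BA[y By xy] <-]; exact: le_trans (dist_to_set_le x By) xy.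
Qed.

Lemma hausdorff_minkowski A B C D : Conv A -> Conv B -> Conv C -> Conv D ->
  hausdorff_dist (minkowski_sum A B) (minkowski_sum C D) <=
  hausdorff_dist A C + hausdorff_dist B D.
Proof.
move=> cA cB cC cD; apply/ler_addgt0Pr => e e0.
have e20 : 0 < e / 2 by rewrite divr_gt0.
apply: hausdorff_le; [exact: Conv_minkowski|exact: Conv_minkowski| |].
  move=> _ [x Ax [y By <-]].
  have [x' Cx xx] := hausdorff_near cA cC Ax e20.
  have [y' Dy yy] := hausdorff_near cB cD By e20.
  exists (x' + y'); first by exists x' => //; exists y'.
  rewrite opprD addrACA (le_trans (enormD _ _))//.
  by rewrite (le_trans (lerD xx yy))// addrACA -splitr.
move=> _ [x Cx [y Dy <-]]; rewrite (hausdorffC A) (hausdorffC B).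
have [x' Ax xx] := hausdorff_near cC cA Cx e20.
have [y' By yy] := hausdorff_near cD cB Dy e20.
exists (x' + y'); first by exists x' => //; exists y'.
rewrite opprD addrACA (le_trans (enormD _ _))//.
by rewrite (le_trans (lerD xx yy))// addrACA -splitr.
Qed.

Lemma supp_hausdorff A B u : Conv A -> Conv B ->
  `|supp A u - supp B u| <= enorm u * hausdorff_dist A B.
Proof.
move=> cA cB; have half C D : Conv C -> Conv D ->
    supp C u - supp D u <= enorm u * hausdorff_dist C D.
  move=> cC cD; apply/ler_addgt0Pr => e e0.
  (* Scaled so that [enorm u] times this slack is at most [e], even when [u] vanishes. *)
  have eu0 : 0 < e / (enorm u + 1) by rewrite divr_gt0// ltr_wpDl// enorm_ge0.
  rewrite lerBlDr; apply: supp_le => // x Cx.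
  have [y Dy xy] := hausdorff_near cC cD Cx eu0.
  have -> : dot x u = dot (x - y) u + dot y u by rewrite -dotDl subrK.
  rewrite lerD ?supp_ge// (le_trans (dot_le _ _))// mulrC.
  rewrite (le_trans (ler_wpM2l (enorm_ge0 u) xy))// mulrDr lerD2l.
  rewrite mulrA ler_pdivrMr ?ltr_wpDl ?enorm_ge0// mulrC ler_wpM2l ?(ltW e0)//.
  by rewrite lerDl.
rewrite ler_norml half// andbT lerNl opprB hausdorffC; exact: half.
Qed.

Lemma hausdorff_dist_ge0 A B : Conv A -> Conv B -> 0 <= hausdorff_dist A B.
Proof.
move=> cA cB; case: (cA) => -[x Ax] _ _; rewrite leNgt; apply/negP => H.
have e0 : 0 < - hausdorff_dist A B / 2 by rewrite divr_gt0// oppr_gt0.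
have [y _] := hausdorff_near cA cB Ax e0.
by have := enorm_ge0 (x - y); lra.
Qed.

Section Derivative.
Variables (T : R) (T0 : 0 < T).
Implicit Types G : R -> set 'rV[R]_d.

(** Writing [G (t + h)] as [G t] plus its Hukuhara difference [C] turns the quotient into the
    support function of [C] scaled by [h^-1], which is Hausdorff-close to [D]. *)
Lemma hukuhara_derivative_right G t D u :
  (forall t, t \in `[0, T] -> Conv (G t)) ->
  is_hukuhara_derivative T G t D -> 0 <= t -> t < T ->
  h^-1 * (supp (G (t + h)) u - supp (G t) u) @[h --> 0^'+] --> supp D u.
Proof.
move=> cG [cD + _] t0 tT => /(_ tT) GD.
apply/cvgrPdist_le => e e0.
have eu0 : 0 < e / (enorm u + 1) by rewrite divr_gt0// ltr_wpDl// enorm_ge0.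
have tT' : 0 < T - t by rewrite subr_gt0.
have := GD _ eu0; near_simpl => {}GD.
near=> h.
have h0 : 0 < h by near: h; exact: nbhs_right_gt.
have hT : h < T - t by near: h; exact: nbhs_right_lt.
have [C [cC GC] CD] : exists2 C, is_hukuhara_diff (G (t + h)) (G t) C &
  hausdorff_dist (scale_set h^-1 C) D < e / (enorm u + 1) by near: h; exact: GD.
have cGt : Conv (G t) by apply: cG; rewrite in_itv/=; apply/andP; split; lra.
rewrite GC supp_minkowski// addrAC subrr add0r.
rewrite -supp_scale// ?invr_ge0 ?(ltW h0)// distrC.
rewrite (le_trans (supp_hausdorff _ _ _))//; first exact: Conv_scale.
rewrite (le_trans (ler_wpM2l (enorm_ge0 u) (ltW CD)))//.
rewrite mulrA ler_pdivrMr ?ltr_wpDl ?enorm_ge0// mulrC ler_wpM2l ?(ltW e0)//.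
by rewrite lerDl.
Unshelve. all: by end_near. Qed.

Lemma hukuhara_derivative_left G t D u :
  (forall t, t \in `[0, T] -> Conv (G t)) ->
  is_hukuhara_derivative T G t D -> 0 < t -> t <= T ->
  h^-1 * (supp (G t) u - supp (G (t - h)) u) @[h --> 0^'+] --> supp D u.
Proof.
move=> cG [cD _ +] t0 tT => /(_ t0) GD.
apply/cvgrPdist_le => e e0.
have eu0 : 0 < e / (enorm u + 1) by rewrite divr_gt0// ltr_wpDl// enorm_ge0.
have := GD _ eu0; near_simpl => {}GD.
near=> h.
have h0 : 0 < h by near: h; exact: nbhs_right_gt.
have hT : h < t by near: h; exact: nbhs_right_lt.
have [C [cC GC] CD] : exists2 C, is_hukuhara_diff (G t) (G (t - h)) C &
  hausdorff_dist (scale_set h^-1 C) D < e / (enorm u + 1) by near: h; exact: GD.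
have cGt : Conv (G (t - h)) by apply: cG; rewrite in_itv/=; apply/andP; split; lra.
rewrite GC supp_minkowski// addrAC subrr add0r.
rewrite -supp_scale// ?invr_ge0 ?(ltW h0)// distrC.
rewrite (le_trans (supp_hausdorff _ _ _))//; first exact: Conv_scale.
rewrite (le_trans (ler_wpM2l (enorm_ge0 u) (ltW CD)))//.
rewrite mulrA ler_pdivrMr ?ltr_wpDl ?enorm_ge0// mulrC ler_wpM2l ?(ltW e0)//.
by rewrite lerDl.
Unshelve. all: by end_near. Qed.

(** The support functions of both derivatives are limits of the same quotient, taken from the right
    before [T] and from the left at [T]. *)
Lemma hukuhara_derivative_uniq G t D D' :
  (forall t, t \in `[0, T] -> Conv (G t)) -> t \in `[0, T] ->
  is_hukuhara_derivative T G t D -> is_hukuhara_derivative T G t D' -> D = D'.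
Proof.
move=> cG; rewrite in_itv/= => /andP[t0 tT] GD GD'.
apply: Conv_eq_supp => [||u]; [by case: GD|by case: GD'|].
have [tT'|tT'] := ltP t T.
  have := hukuhara_derivative_right (u := u) cG GD t0 tT'.
  have := hukuhara_derivative_right (u := u) cG GD' t0 tT'.
  by move=> /[swap]; exact: cvg_unique.
have {}t0 : 0 < t by exact: lt_le_trans tT'.
have := hukuhara_derivative_left (u := u) cG GD t0 tT.
have := hukuhara_derivative_left (u := u) cG GD' t0 tT.
by move=> /[swap]; exact: cvg_unique.
Qed.

Lemma D_H_P G t : hukuhara_differentiable T G -> t \in `[0, T] ->
  is_hukuhara_derivative T G t (D_H T G t).
Proof. by move=> GH tT; have [D] := GH t tT; exact: xgetI. Qed.

Lemma D_H_eq G t D : (forall t, t \in `[0, T] -> Conv (G t)) -> t \in `[0, T] ->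
  is_hukuhara_derivative T G t D -> D_H T G t = D.
Proof.
move=> cG tT GD; apply: hukuhara_derivative_uniq (GD) => //.
exact: xgetI GD.
Qed.

(** Hukuhara differences add up, so the sum of the derivatives is a derivative of the sum; as [D_H]
    is obtained by choice, uniqueness is what turns this into an equality. *)
Lemma D_H_minkowski G1 G2 t : (forall t, t \in `[0, T] -> Conv (G1 t)) ->
  (forall t, t \in `[0, T] -> Conv (G2 t)) ->
  hukuhara_differentiable T G1 -> hukuhara_differentiable T G2 ->
  t \in `[0, T] ->
  D_H T (fun s => minkowski_sum (G1 s) (G2 s)) t =
  minkowski_sum (D_H T G1 t) (D_H T G2 t).
Proof.
move=> cG1 cG2 G1H G2H tT; apply: D_H_eq => //.
  by move=> s sT; apply: Conv_minkowski; [exact: cG1|exact: cG2].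
have [cD1 r1 l1] := D_H_P G1H tT; have [cD2 r2 l2] := D_H_P G2H tT.
have scaleD h (A B : set 'rV[R]_d) : scale_set h (minkowski_sum A B) =
    minkowski_sum (scale_set h A) (scale_set h B).
  apply/seteqP; split.
    move=> _ [_ [x Ax [y By <-]] <-]; exists (h *: x); first by exists x.
    by exists (h *: y); [exists y|rewrite scalerDr].
  move=> _ [_ [x Ax <-] [_ [y By <-] <-]]; exists (x + y); last by rewrite scalerDr.
  by exists x => //; exists y.
have key A1 A2 B1 B2 C1 C2 h e : is_hukuhara_diff A1 B1 C1 ->
    is_hukuhara_diff A2 B2 C2 ->
    hausdorff_dist (scale_set h C1) (D_H T G1 t) < e / 2 ->
    hausdorff_dist (scale_set h C2) (D_H T G2 t) < e / 2 ->
    exists2 C, is_hukuhara_diff (minkowski_sum A1 A2) (minkowski_sum B1 B2) C &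
    hausdorff_dist (scale_set h C) (minkowski_sum (D_H T G1 t) (D_H T G2 t)) < e.
  move=> [cC1 ->] [cC2 ->] H1 H2; exists (minkowski_sum C1 C2).
    split; first exact: Conv_minkowski.
    apply/seteqP; split.
      move=> _ [_ [b1 ? [c1 ? <-]] [_ [b2 ? [c2 ? <-]] <-]].
      exists (b1 + b2); first by exists b1 => //; exists b2.
      by exists (c1 + c2); [exists c1 => //; exists c2|rewrite addrACA].
    move=> _ [_ [b1 ? [b2 ? <-]] [_ [c1 ? [c2 ? <-]] <-]].
    exists (b1 + c1); first by exists b1 => //; exists c1.
    by exists (b2 + c2); [exists b2 => //; exists c2|rewrite addrACA].
  rewrite scaleD (le_lt_trans (hausdorff_minkowski _ _ _ _))//; last lra.
    exact: Conv_scale.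
  exact: Conv_scale.
split; first exact: Conv_minkowski.
  move=> /[dup] /r1 {}r1 /r2 {}r2 e e0.
  have e20 : 0 < e / 2 by rewrite divr_gt0.
  apply: filterS2 (r1 _ e20) (r2 _ e20) => h [C1 GC1 H1] [C2 GC2 H2].
  exact: key GC1 GC2 H1 H2.
move=> /[dup] /l1 {}l1 /l2 {}l2 e e0.
have e20 : 0 < e / 2 by rewrite divr_gt0.
apply: filterS2 (l1 _ e20) (l2 _ e20) => h [C1 GC1 H1] [C2 GC2 H2].
exact: key GC1 GC2 H1 H2.
Qed.

(** At interior points the two one-sided limits combine into an ordinary derivative. *)
Lemma supp_is_derive G t u : (forall t, t \in `[0, T] -> Conv (G t)) ->
  hukuhara_differentiable T G -> t \in `]0, T[ ->
  is_derive t 1 (fun s => supp (G s) u) (supp (D_H T G t) u).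
Proof.
move=> cG GH; rewrite in_itv/= => /andP[t0 tT].
have tT' : t \in `[0, T] by rewrite in_itv/= !ltW.
have GD := D_H_P GH tT'.
have r := hukuhara_derivative_right (u := u) cG GD (ltW t0) tT.
have l := hukuhara_derivative_left (u := u) cG GD t0 (ltW tT).
suff H : h^-1 *: (supp (G (h *: 1 + t)) u - supp (G t) u) @[h --> 0^'] -->
    supp (D_H T G t) u.
  apply: DeriveDef; first by apply/cvg_ex; eexists; exact: H.
  exact/cvg_lim.
apply: (@cvg_at_right_left_dnbhs _ R^o).
  apply: cvg_trans r; apply: near_eq_cvg; near=> h.
  by rewrite /= (_ : h *: 1 = h) 1?[t + h]addrC//; exact: mulr1.
apply/cvg_at_leftNP; rewrite oppr0.
apply: cvg_trans l; apply: near_eq_cvg; near=> h.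
rewrite /= (_ : - h *: 1 = - h); last exact: mulr1.
by rewrite invrN scaleNr -scalerN opprB [- h + t]addrC.
Unshelve. all: by end_near. Qed.

End Derivative.

End Hausdorff.
(** * Riesz variation and absolute continuity *)

Section PartitionSums.
Context (R : realType) (V : nmodType).
Implicit Types (K : R -> R -> V) (a b x : R) (s : seq R).

(** Common form of Riesz sums and of the coordinates of Riemann sums, set up for induction on [s].
    The default [b] is never reached, both indices staying within [a :: s]. *)
Definition partition_sum K b a s : V :=
  \sum_(0 <= n < size s) K (nth b (a :: s) n) (nth b (a :: s) n.+1).

Lemma partition_sum_nil K b a : partition_sum K b a [::] = 0.
Proof. by rewrite /partition_sum big_nil. Qed.

Lemma partition_sum_cons K b a x s :
  partition_sum K b a (x :: s) = K a x + partition_sum K b x s.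
Proof. by rewrite /partition_sum /= big_nat_recl. Qed.

Lemma partition_sum_rcons K b b' a x s :
  partition_sum K b a (rcons s x) = partition_sum K b' a s + K (last a s) x.
Proof.
elim: s a => [a|y s ih a] /=.
  by rewrite partition_sum_cons !partition_sum_nil addr0 add0r.
by rewrite !partition_sum_cons ih addrA.
Qed.

End PartitionSums.

Lemma partition_sum_le (R : realType) (T : R) (K : R -> R -> R) (V : R -> R) b a s :
  (forall x y, 0 <= x -> x < y -> y <= T -> K x y <= V y - V x) ->
  0 <= a -> path <%O a s -> last a s <= T ->
  partition_sum K b a s <= V (last a s) - V a.
Proof.
move=> KV; elim: s a => [a _ _ _|x s ih a a0 /= /andP[ax xs] sT].
  by rewrite partition_sum_nil subrr.
have x0 : 0 <= x by rewrite (le_trans a0)// ltW.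
have xT : x <= T.
  by rewrite (le_trans _ sT)//; apply: (@itv_partition_le _ _ _ _ s).
rewrite partition_sum_cons (le_trans (lerD (KV _ _ a0 ax xT) (ih _ x0 xs sT)))//.
by rewrite addrC addrA subrK.
Qed.

Section RieszVariation.
Context (R : realType) (E : Type).
Variables (rho : E -> E -> R) (p T : R) (f : R -> E).
Hypothesis T0 : 0 < T.

Let K s t := rho (f s) (f t) `^ p / (t - s) `^ (p - 1).

Let K0 s t : 0 <= K s t.
Proof. by rewrite divr_ge0 ?powR_ge0. Qed.

Lemma riesz_sumE s : riesz_sum rho p T f s = partition_sum K T 0 s.
Proof. by []. Qed.

Lemma riesz_variation_lty (V : R -> R) :
  (forall s t, 0 <= s -> s < t -> t <= T ->
    rho (f s) (f t) `^ p / (t - s) `^ (p - 1) <= V t - V s) ->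
  (riesz_variation rho p T f < +oo)%E.
Proof.
move=> KV; apply: (@le_lt_trans _ _ (V T - V 0)%:E); last exact: ltry.
apply: ge_ereal_sup => _ [s [ps /eqP ls] <-]; rewrite lee_fin riesz_sumE.
by have := partition_sum_le T KV (lexx 0) ps; rewrite ls lexx; apply.
Qed.

(** [V t] is the variation on [[0, t]]: appending [t] to a partition of [[0, s]] adds exactly the
    term of the pair [s], [t]. Together with [riesz_variation_lty] this reduces finiteness of the
    variation to an estimate on a single subinterval. *)
Lemma riesz_variation_majorant : (riesz_variation rho p T f < +oo)%E ->
  exists V : R -> R, forall s t, 0 <= s -> s < t -> t <= T ->
    rho (f s) (f t) `^ p / (t - s) `^ (p - 1) <= V t - V s.
Proof.
move=> fV; pose S t := [set partition_sum K T 0 s | s in itv_partition 0 t].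
have S0 t : 0 <= t -> S t !=set0.
  rewrite le_eqVlt => /predU1P[<-|t0].
    by exists (partition_sum K T 0 [::]), [::].
  by exists (partition_sum K T 0 [:: t]), [:: t] => //; exact: itv_partition1.
have Sub t : 0 <= t -> t <= T -> has_sup (S t).
  move=> t0 tT; split; first exact: S0.
  have fin : riesz_variation rho p T f \is a fin_num.
    rewrite ge0_fin_numE//; apply: le_trans (ereal_sup_ubound _).
      2: by exists [:: T] => //; exact: itv_partition1.
    by rewrite lee_fin sumr_ge0// => n _; exact: K0.
  exists (fine (riesz_variation rho p T f)) => _ [s st <-].
  rewrite -lee_fin fineK//.
  move: tT; rewrite le_eqVlt => /predU1P[tT|tT].
    by apply: ereal_sup_ubound; exists s => //; rewrite -tT.
  (* Appending [T] makes a partition of [[0, T]] and can only increase the sum. *)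
  apply: (@le_trans _ _ (partition_sum K T 0 (rcons s T))%:E).
    by rewrite lee_fin (partition_sum_rcons _ _ T) lerDl K0.
  apply: ereal_sup_ubound; exists (rcons s T) => //.
  rewrite -cats1; apply: itv_partition_cat st _; exact: itv_partition1.
exists (fun t => sup (S t)) => s t s0 st tT.
have t0 : 0 <= t by rewrite (le_trans s0)// ltW.
have sT : s <= T by rewrite (le_trans _ tT)// ltW.
rewrite lerBrDr -lerBrDl; apply: ge_sup; first exact: S0.
move=> _ [sg sgs <-]; rewrite lerBrDl -/(K s t) addrC.
have ls : last 0 sg = s by case: sgs => _ /eqP.
rewrite -[X in K X]ls -(partition_sum_rcons _ T).
apply: sup_ubound; first exact: (Sub t t0 tT).2.
exists (rcons sg t) => //; rewrite -cats1.
by apply: itv_partition_cat sgs _; exact: itv_partition1.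
Qed.

End RieszVariation.

Section QuantitativeAbsoluteContinuity.
Context (R : realType).
Implicit Types (q V : R -> R) (T p : R).
Local Notation mu := (@lebesgue_measure R).

(* A form of absolute continuity on [0, T]: V controls the increments of q up to
   an arbitrarily small factor and a Lipschitz term. *)
Definition controlled T q := exists2 V : R -> R,
  (forall s t, 0 <= s -> s <= t -> t <= T -> V s <= V t) &
  forall e, 0 < e -> exists2 C, 0 <= C & forall s t, 0 <= s -> s <= t -> t <= T ->
    `|q t - q s| <= e * (V t - V s) + C * (t - s).

Lemma controlledD T q1 q2 : controlled T q1 -> controlled T q2 ->
  controlled T (q1 \+ q2).
Proof.
move=> [V1 V1m V1q] [V2 V2m V2q]; exists (V1 \+ V2).
  by move=> s t s0 st tT; rewrite lerD ?V1m ?V2m.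
move=> e e0; have [C1 C10 qC1] := V1q e e0; have [C2 C20 qC2] := V2q e e0.
exists (C1 + C2); first exact: addr_ge0.
move=> s t s0 st tT; rewrite /= opprD addrACA (le_trans (ler_normD _ _))//.
by rewrite (le_trans (lerD (qC1 _ _ s0 st tT) (qC2 _ _ s0 st tT)))// le_eqVlt;
  apply/orP; left; apply/eqP; ring.
Qed.

Lemma controlledN T q : controlled T q -> controlled T (\- q).
Proof.
move=> [V Vm Vq]; exists V => // e /Vq[C C0 qC]; exists C => // s t s0 st tT.
by rewrite /= -opprD normrN qC.
Qed.

Lemma controlled_dominated T q : (exists2 V : R -> R,
  (forall s t, 0 <= s -> s <= t -> t <= T -> V s <= V t) &
  forall e, 0 < e -> exists2 C, 0 <= C & forall s t, 0 <= s -> s < t -> t <= T ->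
    `|q t - q s| <= e * (V t - V s) + C * (t - s)) -> controlled T q.
Proof.
move=> [V Vm Vq]; exists V => // e /Vq[C C0 qC]; exists C => // s t s0.
rewrite le_eqVlt => /predU1P[<- _|]; last exact: qC.
by rewrite !subrr normr0 !mulr0 addr0.
Qed.

(** The constant solves [e * C ^ (p - 1) = 1]: below it [z <= C], above it [z <= e * z ^ p]. A bound
    on p-th powers thereby becomes a bound with an arbitrarily small factor plus a constant, which
    is the shape of [controlled]. *)
Lemma le_powR_affine p e : 1 < p -> 0 < e ->
  exists2 C, 0 <= C & forall z, 0 <= z -> z <= e * z `^ p + C.
Proof.
move=> p1 e0; exists (e `^ (- (p - 1)^-1)); first exact: powR_ge0.
move=> z z0; have [zC|Cz] := leP z (e `^ (- (p - 1)^-1)).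
  by rewrite ler_wpDl// mulr_ge0 ?powR_ge0// ltW.
have {}z0 : 0 < z by apply: le_lt_trans Cz; exact: powR_ge0.
have p10 : 0 < p - 1 by rewrite subr_gt0.
have : e^-1 <= z `^ (p - 1).
  rewrite -[leLHS]powR_inv1; last exact: ltW.
  rewrite (_ : e `^ (-1) = e `^ (- (p - 1)^-1 * (p - 1))); last first.
    by rewrite mulNr mulVf// gt_eqF.
  rewrite powRrM ge0_ler_powR ?(ltW p10)// ?nnegrE ?powR_ge0// ltW//.
rewrite -[leLHS]mul1r ler_pdivrMr// => zp.
rewrite ler_wpDr ?powR_ge0//.
have -> : p = (p - 1) + 1 by ring.
rewrite powRD; last by rewrite (gt_eqF z0) implybT.
by rewrite powRr1 ?(ltW z0)// mulrA mulrC ler_peMr ?(ltW z0)// mulrC.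
Qed.

(** Apply [le_powR_affine] to the slope of [q] between [s] and [t], then multiply by [t - s]: the
    p-th power of the slope times [t - s] is the Riesz term. *)
Lemma controlled_riesz T p q V : 1 < p ->
  (forall s t, 0 <= s -> s < t -> t <= T ->
    `|q t - q s| `^ p / (t - s) `^ (p - 1) <= V t - V s) -> controlled T q.
Proof.
move=> p1 qV; apply: controlled_dominated; exists V.
  move=> s t s0; rewrite le_eqVlt => /predU1P[->//|st] tT.
  by rewrite -subr_ge0 (le_trans _ (qV _ _ s0 st tT))// divr_ge0 ?powR_ge0.
move=> e e0; have [C C0 eC] := le_powR_affine p1 e0; exists C => // s t s0 st tT.
have ts : 0 < t - s by rewrite subr_gt0.
have := eC (`|q t - q s| / (t - s)); rewrite divr_ge0 ?(ltW ts)// => /(_ isT).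
rewrite ler_pdivrMr// => /le_trans; apply; rewrite mulrDl lerD2r -mulrA.
rewrite ler_pM2l// (le_trans _ (qV _ _ s0 st tT))// le_eqVlt; apply/orP; left.
apply/eqP; rewrite powRM ?invr_ge0 ?(ltW ts)// -mulrA; congr (_ * _).
rewrite -[_^-1]powR_inv1 ?(ltW ts)// -powRrM mulN1r -powRN opprB [1 - p]addrC.
rewrite powRD; last by rewrite (gt_eqF ts) implybT.
by rewrite powRr1 ?(ltW ts).
Qed.

(* psi x is the measure of the part left of x of an open superset of A of small
   measure. *)
Lemma null_set_majorant (A : set R) (e : R) : mu.-negligible A -> 0 < e ->
  exists psi : R -> R, [/\ {homo psi : x y / x <= y},
    forall x y, psi y - psi x <= e &
    forall x, A x -> \forall t \near x^'+, t - x <= psi t - psi x].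
Proof.
move=> [N [mN N0 AN]] e0.
have Nfin : (mu N < +oo)%E by rewrite N0 ltry.
have [U [oU NU UNe]] := lebesgue_regularity_outer mN Nfin e0.
have mU : measurable U by exact: open_measurable.
have Ue : (mu U < e%:E)%E.
  rewrite -(setDUK NU) measureU//; last 2 first.
    exact: measurableD.
    by rewrite setDIK.
  by rewrite [X in (X + _)%E]N0 add0e.
have mI (J : interval R) : measurable (U `&` [set` J]) by exact: measurableI.
have fin (J : interval R) : mu (U `&` [set` J]) \is a fin_num.
  rewrite ge0_fin_numE// (@le_lt_trans _ _ (mu U))//.
    by apply: le_measure; rewrite ?inE//; exact: mI.
  by rewrite (lt_trans Ue)// ltry.
have psiB x t : x <= t -> fine (mu (U `&` `]-oo, t])) -
    fine (mu (U `&` `]-oo, x])) = fine (mu (U `&` `]x, t])).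
  move=> xt; rewrite (@itv_bndbnd_setU _ _ _ (BRight x)) ?bnd_simp// setIUr.
  rewrite (_ : mu _ = (mu (U `&` `]-oo, x]) + mu (U `&` `]x, t]))%E).
    by rewrite fineD//; ring.
  apply: measureU; [exact: mI|exact: mI|apply/seteqP; split => // z [] [_ /=]].
  by rewrite !in_itv/= => zx [_] /andP[]; rewrite ltNge zx.
exists (fun x => fine (mu (U `&` `]-oo, x]))); split.
- move=> x t xt; rewrite -subr_ge0 psiB//.
  by rewrite fine_ge0.
- move=> x t; apply: (@le_trans _ _ (fine (mu (U `&` `]-oo, t])))).
    by rewrite gerBl fine_ge0.
  rewrite -lee_fin fineK//; apply: ltW; apply: le_lt_trans Ue.
  by apply: le_measure; rewrite ?inE//; exact: mI.
- move=> x /AN /NU Ux.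
  have /nbhs_ballP[r /= r0 xr] : nbhs x U by exact: open_nbhs_nbhs.
  near=> t.
  have xt : x < t by near: t; exact: nbhs_right_gt.
  have tr : t < x + r by near: t; apply: nbhs_right_lt; rewrite ltrDl.
  rewrite psiB ?(ltW xt)// (_ : U `&` `]x, t] = `]x, t]%classic).
    by rewrite lebesgue_measure_itv/= lte_fin xt.
  apply/setIidPr => z; rewrite /= in_itv/= => /andP[xz zt]; apply: xr.
  by rewrite /ball/= ltr_norml; apply/andP; split; lra.
Unshelve. all: by end_near. Qed.

(* If q, a majorant V, and psi as in null_set_majorant are combined into
   Phi = q + e id + h V + C psi, then Phi cannot drop to the right of any point:
   off the null set because q' >= 0, on it because C psi compensates the
   Lipschitz term of q. *)
Lemma controlled_le T q a b : controlled T q -> 0 <= a -> a <= b -> b <= T ->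
  {ae mu, forall x, x \in `]a, b[ -> exists2 l, 0 <= l & is_derive x 1 q l} ->
  q a <= q b.
Proof.
move=> [V Vm Vq] a0 ab bT der.
have hi (d : R) : 0 < d -> q a <= q b + d.
  (* The terms in [e], [h] and [psi] of [Phi] are each to vary by at most [d / 3] from [a] to [b].
     The added ones keep the denominators positive. *)
  move=> d0; pose e := d / (3 * (b - a + 1)); pose h := d / (3 * (V b - V a + 1)).
  have ba1 : 0 < b - a + 1 by rewrite ltr_wpDl// subr_ge0.
  have Vba1 : 0 < V b - V a + 1 by rewrite ltr_wpDl// subr_ge0 Vm.
  have e0 : 0 < e by rewrite divr_gt0// mulr_gt0.
  have h0 : 0 < h by rewrite divr_gt0// mulr_gt0.
  have [C C0 qC] := Vq h h0.
  (* The total increase of [psi] is fixed last, since it must absorb the factor [C], which depends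
     on [h]. *)
  pose dl := d / (3 * (C + 1)).
  have C1 : 0 < C + 1 by rewrite ltr_wpDl.
  have dl0 : 0 < dl by rewrite divr_gt0// mulr_gt0.
  (* The derivative is known only inside []a, b[], so the starting point [a] joins the exceptional
     set and is handled by [psi]. *)
  have nA : mu.-negligible ([set x | ~ (x \in `]a, b[ ->
      exists2 l, 0 <= l & is_derive x 1 q l)] `|` [set a]).
    apply: negligibleU; first exact: der.
    by apply/negligibleP; [exact: measurable_set1|exact: lebesgue_measure_set1].
  have [psi [psim psie psiA]] := null_set_majorant nA dl0.
  pose Phi x := q x + e * x + h * V x + C * psi x.
  pose S := [set x | a <= x <= b /\ Phi a <= Phi x].
  have Sa : S a by split; rewrite ?lexx.
  have hS : has_sup S.
    by split; [exists a|exists b => x [] /andP[]].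
  pose u := sup S.
  have au : a <= u by apply: sup_ubound => //; exact: hS.2.
  have ub : u <= b by apply: ge_sup; [exists a|move=> x [] /andP[]].
  (* [V] and [psi] may jump, but only upward: from [x] to [u] the function [Phi] loses at most
     [C * (u - x)], so the supremum [u] belongs to [S]. *)
  have Phiu : Phi a <= Phi u.
    apply/ler_addgt0Pr => k k0.
    have kC : 0 < k / (C + 1) by rewrite divr_gt0.
    have [x [/andP[ax xb] ax'] ux] := sup_adherent kC hS.
    have xu : x <= u.
      by apply: sup_ubound; [exact: hS.2|split => //; rewrite ax xb].
    apply: (le_trans ax'); rewrite /Phi -/u in ux *.
    have := qC x u (le_trans a0 ax) xu (le_trans ub bT).
    rewrite ler_norml => /andP[H _].
    have : C * psi x <= C * psi u by rewrite ler_wpM2l// psim.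
    have : e * x <= e * u by rewrite ler_pM2l.
    have : C * (u - x) <= k.
      apply: (@le_trans _ _ ((C + 1) * (u - x))).
        by rewrite ler_wpM2r ?subr_ge0// lerDl.
      by rewrite mulrC -ler_pdivlMr//; lra.
    by lra.
  have [ub'|bu] := ltP u b; last first.
    have uE : u = b by apply/eqP; rewrite eq_le ub bu.
    move: Phiu; rewrite uE /Phi => Phib.
    have : e * (b - a) <= d / 3.
      rewrite /e invfM mulrA -mulrA -[leRHS]mulr1 ler_pM2l ?divr_gt0//.
      by rewrite mulrC ler_pdivrMr// mul1r lerDl.
    have : h * (V b - V a) <= d / 3.
      rewrite /h invfM mulrA -mulrA -[leRHS]mulr1 ler_pM2l ?divr_gt0//.
      by rewrite mulrC ler_pdivrMr// mul1r lerDl.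
    have : C * (psi b - psi a) <= d / 3.
      apply: (@le_trans _ _ (C * dl)); first by rewrite ler_wpM2l.
      have -> : C * dl = d / 3 * (C / (C + 1)) by rewrite /dl invfM; ring.
      by rewrite ger_pMr ?divr_gt0// ler_pdivrMr// mul1r lerDl.
    by lra.
  suff [t [ut tb Put]] : exists t, [/\ u < t, t <= b & Phi u <= Phi t].
    have St : S t.
      by split; [rewrite tb (le_trans au)// ltW|exact: le_trans Put].
    by have := sup_ubound hS.2 St; rewrite leNgt ut.
  have u0 : 0 <= u by exact: le_trans au.
  suff near_u : \forall t \near u^'+, t <= b -> Phi u <= Phi t.
    near u^'+ => t; exists t.
    have ut : u < t by near: t; exact: nbhs_right_gt.
    have tb : t <= b by near: t; exact: nbhs_right_le.
    by split => //; move: tb; near: t.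
  have [uA|uA] := pselect (([set x | ~ (x \in `]a, b[ ->
      exists2 l, 0 <= l & is_derive x 1 q l)] `|` [set a]) u).
    near=> t => tb; have ut : u < t by near: t; exact: nbhs_right_gt.
    have : t - u <= psi t - psi u by near: t; exact: psiA.
    move=> /(ler_wpM2l C0); have := qC u t u0 (ltW ut) (le_trans tb bT).
    rewrite ler_norml /Phi => /andP[H _].
    have : e * u <= e * t by rewrite ler_pM2l// ltW.
    by lra.
  have {}au : a < u.
    by rewrite lt_neqAle au andbT; apply/eqP => aE; apply: uA; right.
  have [l l0 [dq Dq]] : exists2 l, 0 <= l & is_derive u 1 q l.
    apply: contrapT => H; apply: uA; left => /= H2; apply: H; apply: H2.
    by rewrite in_itv/= au ub'.
  have : h^-1 *: (q (h *: 1 + u) - q u) @[h --> 0^'] --> l.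
    by rewrite -Dq; exact: dq.
  move=> /cvg_dnbhs_at_right/cvgrPdist_le/(_ _ e0) He.
  apply/nbhs_right0P; near=> k => kb.
  have k0 : 0 < k by near: k; exact: nbhs_right_gt.
  have : `|l - k^-1 *: (q (k *: 1 + u) - q u)| <= e by near: k; exact: He.
  rewrite (_ : k *: 1 = k); last exact: mulr1.
  rewrite ler_norml => /andP[_]; rewrite lerBlDr -lerBlDl => le_e.
  have : (l - e) * k <= q (u + k) - q u.
    by rewrite -ler_pdivlMr// mulrC (addrC u).
  have uk : u <= u + k by rewrite lerDl ltW.
  have : 0 <= l * k by rewrite mulr_ge0// ltW.
  have : h * V u <= h * V (u + k) by rewrite ler_pM2l// Vm// (le_trans kb).
  have : C * psi u <= C * psi (u + k) by rewrite ler_wpM2l// psim.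
  by rewrite /Phi; lra.
apply/ler_addgt0Pr => d d0; exact: hi.
Unshelve. all: by end_near. Qed.

End QuantitativeAbsoluteContinuity.
(** * Measurable selection *)

Section MeasurableSelection.
Context (R : realType) (n : nat).
Implicit Types (x y u : 'rV[R]_n).

Lemma dense_sequence : exists q : nat -> 'rV[R]_n,
  forall x e, 0 < e -> exists k, enorm (x - q k) < e.
Proof.
pose q k : 'rV[R]_n := if @unpickle ('rV[rat]_n) k is Some r then map_mx ratr r else 0.
exists q => x e e0; pose h := e / (n%:R + 1).
have n1 : 0 < n%:R + 1 :> R by rewrite ltr_wpDl.
have h0 : 0 < h by rewrite divr_gt0.
have xr i : exists r : rat, `|x ord0 i - ratr r| < h.
  have [|r] := @rat_in_itvoo R (x ord0 i - h) (x ord0 i + h); first lra.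
  by rewrite in_itv/= => /andP[? ?]; exists r; rewrite ltr_norml; apply/andP; split; lra.
pose r : 'rV[rat]_n := \row_i xchoose (xr i).
exists (pickle r); rewrite /q pickleK (le_lt_trans (enorm_le_sum _))//.
apply: (@le_lt_trans _ _ (n%:R * h)).
  rewrite -[X in X%:R]card_ord mulr_natl -sumr_const ler_sum// => i _.
  by rewrite !mxE ltW// (xchooseP (xr i)).
by rewrite /h mulrA ltr_pdivrMr// mulrC ltr_pM2l// ltrDl.
Qed.

(** Hence the infimum of a continuous function over the sequence bounds it from below everywhere;
    being countable, such an infimum is measurable in a parameter. *)
Lemma dense_sequence_near (q : nat -> 'rV[R]_n) (f : 'rV[R]_n -> R) x e :
  (forall x e, 0 < e -> exists k, enorm (x - q k) < e) ->
  continuous f -> 0 < e -> exists k, f (q k) < f x + e.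
Proof.
move=> dq cf e0.
have /(@nbhs_ballP R 'rV[R]_n) [r /= r0 xr] : nbhs x [set y | `|f x - f y| < e].
  exact: (proj1 (@cvgrPdist_lt R R^o _ (nbhs x) _ f (f x)) (cf x)).
have [k kr] := dq x r r0; exists k.
have : `|f x - f (q k)| < e.
  by apply: xr; rewrite -ball_normE /= (le_lt_trans (norm_le_enorm _)).
by rewrite ltr_norml => /andP[? ?]; lra.
Qed.

(** The least admissible index works: that it equals [k] is a condition on the finitely many tests
    [c j] with [j <= k]. *)
Lemma measurable_first_index d (T : measurableType d) (D : set T)
    (c : nat -> T -> bool) : measurable D ->
  (forall k, measurable_fun D (c k)) -> (forall t, D t -> exists k, c k t) ->
  exists2 i : T -> nat, measurable_fun D i & forall t, D t -> c (i t) t.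
Proof.
move=> mD mc cD.
pose i t := if pselect (exists k, c k t) is left e then ex_minn e else 0%N.
exists i; last first.
  by move=> t /cD ct; rewrite /i; case: pselect => // e; case: ex_minnP.
pose e k t := c k t && all (fun j => ~~ c j t) (iota 0 k).
have me k : measurable_fun D (e k).
  apply: measurable_and; first exact: mc.
  elim: (iota 0 k) => [|j s ih] /=; first exact: measurable_cst.
  by apply: measurable_and => //; apply: measurable_neg; exact: mc.
have iE t k : D t -> (i t = k) <-> e k t.
  move=> Dt; rewrite /i; case: pselect => [ex|/(_ (cD _ Dt))//].
  case: ex_minnP => m cm mmin; split=> [<-|/andP[ck kmin]].
    rewrite /e cm/=; apply/allP => j; rewrite mem_iota/= add0n => jm.
    by apply/negP => /mmin; rewrite leqNgt jm.
  apply/eqP; rewrite eqn_leq mmin//= leqNgt; apply/negP => mk.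
  by move/allP: kmin => /(_ m); rewrite mem_iota/= add0n mk cm => /(_ isT).
move=> _ Y _.
have -> : D `&` i @^-1` Y = \bigcup_(k in Y) (D `&` e k @^-1` [set true]).
  apply/seteqP; split=> [t [Dt Yt]|t [k Yk [Dt /= ek]]].
    by exists (i t) => //; split => //=; exact/iE.
  by split => //=; move/iE: ek => ->.
by apply: bigcup_measurable => k _; exact: me.
Qed.

(* The selection is the limit of near minimizers, in a dense sequence, of
   x |-> |x|^2 + N * (sum of the first N constraint violations at x), which
   converge by the parallelogram law. *)
Lemma measurable_selection d (T : measurableType d) (D : set T)
    (u : nat -> 'rV[R]_n) (c : nat -> T -> R) : measurable D ->
  (forall k, measurable_fun D (c k)) ->
  (forall t, D t -> exists x, forall k, dot x (u k) <= c k t) ->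
  exists2 phi : T -> 'rV[R]_n,
    forall i, measurable_fun D (fun t => phi t ord0 i) &
    forall t, D t -> forall k, dot (phi t) (u k) <= c k t.
Proof.
move=> mD mc cD; have [q dq] := dense_sequence.
pose viol k t x := Num.max 0 (dot x (u k) - c k t).
pose J N t x := dot x x + N%:R * \sum_(k < N) viol k t x.
have viol0 k t x : 0 <= viol k t x by rewrite le_max lexx.
have sviol0 N t x : 0 <= \sum_(k < N) viol k t x by rewrite sumr_ge0.
have J0 N t x : 0 <= J N t x by rewrite addr_ge0 ?dot_ge0// mulr_ge0.
have Jmono N M t x : (N <= M)%N -> J N t x <= J M t x.
  move=> NM; rewrite lerD2l ler_pM ?ler_nat//.
  rewrite -!(big_mkord xpredT (fun k => viol k t x)).
  by rewrite [leRHS](big_cat_nat (leq0n N) NM)/= lerDl sumr_ge0.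
have cvgJ N t x (F : set_system 'rV[R]_n) : Filter F ->
    enorm y @[y --> F] --> enorm x ->
    (forall v, dot y v @[y --> F] --> dot x v) -> J N t y @[y --> F] --> J N t x.
  move=> FF cn cd; apply: cvgD.
    rewrite -sqr_enorm (_ : (fun y => dot y y) = fun y => enorm y * enorm y).
      by rewrite expr2; apply: cvgM.
    by apply/funext => y; rewrite -sqr_enorm expr2.
  apply: cvgM; first exact: cvg_cst.
  apply: cvg_big => [|k _]; first exact: add_continuous.
  have cdot : dot y (u k) - c k t @[y --> F] --> dot x (u k) - c k t.
    by apply: cvgB => //; exact: cvg_cst.
  rewrite /viol; under eq_fun do rewrite maxr_absE; rewrite maxr_absE.
  apply: cvgM; last exact: cvg_cst.
  apply: cvgD; first by apply: cvgD => //; exact: cvg_cst.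
  by apply: cvg_norm; apply: cvgB => //; exact: cvg_cst.
have cJ N t : continuous (J N t).
  move=> x; apply: (cvgJ N t x (nbhs x) (nbhs_filter x)); first exact: continuous_enorm.
  by move=> v; exact: continuous_dot.
(* Strong convexity, with a modulus independent of [N]: the parallelogram law for the quadratic
   term, plain convexity for the violations. *)
have Jmid N t x y : dot (x - y) (x - y) / 4 <=
    (J N t x + J N t y) / 2 - J N t (2^-1 *: (x + y)).
  have : \sum_(k < N) viol k t (2^-1 *: (x + y)) <=
      (\sum_(k < N) viol k t x + \sum_(k < N) viol k t y) / 2.
    rewrite -big_split/= mulr_suml; apply: ler_sum => k _.
    rewrite /viol dotZl dotDl ge_max; apply/andP; split.
      by rewrite divr_ge0// addr_ge0// le_max lexx.
    have : dot x (u k) - c k t <= Num.max 0 (dot x (u k) - c k t).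
      by rewrite le_max lexx orbT.
    have : dot y (u k) - c k t <= Num.max 0 (dot y (u k) - c k t).
      by rewrite le_max lexx orbT.
    by lra.
  move=> /(ler_wpM2l (ler0n R N)).
  rewrite /J !(dotZl, dotZr, dotBl, dotBr, dotDl, dotDr) (dotC y x).
  by lra.
pose m N t := inf (range (fun k => J N t (q k))).
have hm N t : has_inf (range (fun k => J N t (q k))).
  by split; [exists (J N t (q 0%N)), 0%N|exists 0 => _ [k _ <-]].
have mm N : measurable_fun D (m N).
  have -> : m N = fun t => infs (fun k => J N t (q k)) 0%N.
    apply/funext => t; rewrite /infs /m; congr inf.
    by apply/seteqP; split => _ [k _ <-]; exists k.
  apply: (@measurable_fun_infs _ _ _ _ (fun k t => J N t (q k))).
    by move=> t _; exists 0 => _ [k _ <-].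
  move=> k; apply: measurable_funD; first exact: measurable_cst.
  apply: measurable_funM; first exact: measurable_cst.
  apply: measurable_sum => j; apply: measurable_maxr; first exact: measurable_cst.
  by apply: measurable_funB; [exact: measurable_cst|exact: mc].
have mJ N t x : m N t <= J N t x.
  apply/ler_addgt0Pr => e e0.
  have [k kx] := dense_sequence_near x dq (cJ N t) e0.
  by apply: le_trans (ltW kx); apply: inf_lbound; [exact: (hm N t).2|exists k].
have inv0 N : 0 < N.+1%:R^-1 :> R by rewrite invr_gt0.
have sel N : exists2 i : T -> nat, measurable_fun D i &
    forall t, D t -> J N t (q (i t)) < m N t + N.+1%:R^-1.
  apply: (@measurable_first_index _ _ _
    (fun k t => J N t (q k) < m N t + N.+1%:R^-1)) => //.
    move=> k; apply: measurable_fun_ltr.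
      apply: measurable_funD; first exact: measurable_cst.
      apply: measurable_funM; first exact: measurable_cst.
      apply: measurable_sum => j; apply: measurable_maxr; first exact: measurable_cst.
      by apply: measurable_funB; [exact: measurable_cst|exact: mc].
    by apply: measurable_funD => //; exact: measurable_cst.
  move=> t _; have [_ [k _ <-] ?] := inf_adherent (inv0 N) (hm N t).
  by exists k.
have /choice[i iP] : forall N, exists i : T -> nat, measurable_fun D i /\
    forall t, D t -> J N t (q (i t)) < m N t + N.+1%:R^-1.
  by move=> N; have [i ? ?] := sel N; exists i.
pose z N t := q (i N t).
have zc t j : D t -> cvgn (fun N => z N t ord0 j).
  move=> Dt; have [a aK] := cD t Dt.
  (* A feasible point pays no penalty, so the minima [m N t] stay below [dot a a] for all [N]; they
     therefore have a finite supremum. *)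
  have Ja N : J N t a = dot a a.
    rewrite /J big1 ?mulr0 ?addr0// => k _; apply/max_idPl.
    by rewrite subr_le0 aK.
  have hsup : has_sup (range (m ^~ t)).
    by split; [exists (m 0%N t), 0%N|exists (dot a a) => _ [N _ <-]; rewrite -(Ja N)].
  apply: cauchy_cvg; apply: cauchy_exP => e e0.
  (* Three errors of this size occur: the distance of [m N t] to its supremum and the slacks of the
     two near minimizers. [Jmid] then bounds the squared distance by three quarters of [e ^+ 2]. *)
  have e20 : 0 < e ^+ 2 / 8 by rewrite divr_gt0// exprn_gt0.
  have [_ [N1 _ <-] HN1] := sup_adherent e20 hsup.
  have [N2 HN2] : exists N, N.+1%:R^-1 < e ^+ 2 / 8 :> R.
    by have [N _ HN] := near_infty_natSinv_lt (PosNum e20); exists N; apply: (HN N) => /=.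
  pose N := maxn N1 N2.
  have mN1 : m N1 t <= m N t.
    apply: lb_le_inf; first exact: (hm N t).1.
    move=> _ [k _ <-]; apply: le_trans (Jmono N1 N t (q k) (leq_maxl _ _)).
    exact: mJ.
  exists (z N t ord0 j); exists N => // M /= NM.
  rewrite /ball/=.
  have zMN : enorm (z N t - z M t) < e.
    rewrite -ltr_sqr ?nnegrE ?enorm_ge0 ?(ltW e0)// sqr_enorm.
    have := Jmid N t (z N t) (z M t).
    have := mJ N t (2^-1 *: (z N t + z M t)).
    have := (iP N).2 t Dt; rewrite -/(z N t).
    have := (iP M).2 t Dt; rewrite -/(z M t).
    have := Jmono N M t (z M t) NM.
    have : m M t <= sup (range (m ^~ t)).
      by apply: sup_ubound; [exact: hsup.2|exists M].
    have hN : N.+1%:R^-1 < e ^+ 2 / 8 :> R.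
      apply: le_lt_trans HN2; rewrite lef_pV2 ?posrE// ler_nat ltnS.
      exact: leq_maxr.
    have hM : M.+1%:R^-1 <= N.+1%:R^-1 :> R by rewrite lef_pV2 ?posrE// ler_nat ltnS.
    move: e20 hN hM HN1 mN1.
    move: (N.+1%:R^-1) (M.+1%:R^-1) (e ^+ 2) (sup _) => a1 a2 a3 a4.
    move: (dot (z N t - _) _) (J N t (z N t)) (J N t (z M t)) (J M t (z M t)).
    move: (J N t _) (m N t) (m M t) (m N1 t) => *; lra.
  apply: le_lt_trans zMN; have := coord_le_enorm (z N t - z M t) j.
  by rewrite !mxE.
exists (fun t => \row_j limn (fun N => z N t ord0 j)).
  move=> j; apply: (@measurable_fun_cvg _ _ _ _ (fun N t => z N t ord0 j)).
    move=> N; apply: (@measurableT_comp _ _ _ _ _ _ (fun k => q k ord0 j)) => //.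
    exact: (iP N).1.
  by move=> t Dt; rewrite mxE; exact: zc.
move=> t Dt k; have [a aK] := cD t Dt.
set phi := \row__ _.
have zphi : dot (z N t) (u k) @[N --> \oo] --> dot phi (u k).
  apply: cvg_big => [|j _]; first exact: add_continuous.
  apply: cvgM; last exact: cvg_cst.
  by rewrite mxE; exact: zc.
have Ja N : J N t a = dot a a.
  rewrite /J big1 ?mulr0 ?addr0// => l _; apply/max_idPl.
  by rewrite subr_le0 aK.
have aa0 := dot_ge0 a.
(* The penalty forces [N * viol k] to be at most [dot a a + 1]; the factor 2 comes from
   [N + 1 <= 2 * N], valid once [k < N], and brings the bound to the harmonic sequence. *)
have bnd : c k t + 2 * (dot a a + 1) * N.+1%:R^-1 @[N --> \oo] -->
    c k t + 2 * (dot a a + 1) * 0.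
  apply: cvgD; first exact: cvg_cst.
  by apply: cvgM; [exact: cvg_cst|exact: cvg_harmonic].
rewrite mulr0 addr0 in bnd.
apply: (ler_cvg_to zphi bnd); exists k.+1 => // N /= kN.
rewrite -lerBlDl ler_pdivlMr//.
have vN : N%:R * viol k t (z N t) <= dot a a + 1.
  apply: (@le_trans _ _ (J N t (z N t))).
    apply: (@le_trans _ _ (N%:R * \sum_(k < N) viol k t (z N t))); last first.
      by rewrite /J lerDr dot_ge0.
    rewrite ler_wpM2l// (bigD1 (Ordinal kN))//= lerDl sumr_ge0//.
  apply: le_trans (ltW ((iP N).2 t Dt)) _; rewrite lerD//.
    by rewrite -(Ja N).
  by rewrite invf_le1// ler1n.
apply: (@le_trans _ _ (viol k t (z N t) * N.+1%:R)).
  by rewrite ler_wpM2r// /viol le_max lexx orbT.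
apply: (@le_trans _ _ (2 * (N%:R * viol k t (z N t)))); last by rewrite ler_wpM2l.
rewrite mulrA mulrC ler_wpM2r// -natrM ler_nat mul2n -addnn.
by rewrite -addn1 leq_add2l; exact: leq_trans kN.
Qed.

End MeasurableSelection.
(** * Primitives of Lp functions *)

Section AlmostEverywhere.
Context (R : realType).
Local Notation mu := (@lebesgue_measure R).

Lemma ae_imply (P Q : R -> Prop) : (forall x, P x -> Q x) ->
  {ae mu, forall x, P x} -> {ae mu, forall x, Q x}.
Proof. by move=> PQ; apply: (@filterS _ _ (ae_filter_ringOfSetsType mu)). Qed.

Lemma ae_imply2 (P1 P2 Q : R -> Prop) : (forall x, P1 x -> P2 x -> Q x) ->
  {ae mu, forall x, P1 x} -> {ae mu, forall x, P2 x} -> {ae mu, forall x, Q x}.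
Proof. by move=> PQ; apply: (@filterS2 _ _ (ae_filter_ringOfSetsType mu)). Qed.

Lemma ae_forall (I : finType) (P : I -> R -> Prop) :
  (forall i, {ae mu, forall t, P i t}) -> {ae mu, forall t, forall i, P i t}.
Proof. exact: (@filter_forall _ _ P _ (ae_filter_ringOfSetsType mu)). Qed.

Lemma ae_itv_cc_oo a b (P : R -> Prop) :
  {ae mu, forall t : R, t \in `[a, b] -> P t} ->
  {ae mu, forall t : R, t \in `]a, b[ -> P t}.
Proof.
apply: ae_imply => t H; rewrite in_itv/= => /andP[ta tb]; apply: H.
by rewrite in_itv/= !ltW.
Qed.

Lemma ae_itv_oo_cc a b (P : R -> Prop) :
  {ae mu, forall t : R, t \in `]a, b[ -> P t} ->
  {ae mu, forall t : R, t \in `[a, b] -> P t}.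
Proof.
have ae_neq x : {ae mu, forall t : R, t != x}.
  exists [set x]; split; [exact: measurable_set1|exact: lebesgue_measure_set1|].
  by move=> t /= /negP; rewrite negbK => /eqP.
have := ae_imply2 (fun _ a b => conj a b) (ae_neq a) (ae_neq b).
apply: ae_imply2 => t [ta tb] H; rewrite in_itv/= => /andP[at_ tb_].
by apply: H; rewrite in_itv/= !lt_neqAle at_ tb_ tb eq_sym ta.
Qed.

End AlmostEverywhere.

Section Primitive.
Context (R : realType).
Implicit Types (psi g : R -> R) (T p : R).
Local Notation mu := (@lebesgue_measure R).

Definition prim psi (t : R) : R := \int[mu]_(x in `[0, t]) psi x.

Let integrable_itv psi (J : interval R) : mu.-integrable setT (EFin \o psi) ->
  mu.-integrable [set` J] (EFin \o psi).
Proof. by apply: integrableS. Qed.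

Lemma primB psi s t : mu.-integrable setT (EFin \o psi) -> 0 <= s -> s <= t ->
  prim psi t - prim psi s = \int[mu]_(x in `]s, t]) psi x.
Proof.
move=> ipsi s0 st; rewrite /prim Rintegral_itvB ?bnd_simp//.
exact: integrable_itv.
Qed.

Lemma norm_primB psi s t : mu.-integrable setT (EFin \o psi) -> 0 <= s -> s <= t ->
  `|prim psi t - prim psi s| <= prim (fun x => `|psi x|) t - prim (fun x => `|psi x|) s.
Proof.
move=> ipsi s0 st; rewrite primB// primB//; last exact: integrable_norm.
by apply: le_normr_Rintegral => //; exact: integrable_itv.
Qed.

Lemma prim_norm_le psi s t : mu.-integrable setT (EFin \o psi) -> 0 <= s ->
  s <= t -> prim (fun x => `|psi x|) t - prim (fun x => `|psi x|) s <= \int[mu]_x `|psi x|.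
Proof.
move=> ipsi s0 st; have inpsi := integrable_norm ipsi.
rewrite primB// Rintegral_mkcond; apply: le_Rintegral => //.
  by rewrite -restrict_EFin -integrable_mkcond//; exact: integrable_itv.
by move=> x _; rewrite patchE; case: ifPn => _; [exact: lexx|exact: normr_ge0].
Qed.

Lemma prim_is_derive psi : mu.-integrable setT (EFin \o psi) ->
  {ae mu, forall x : R, 0 < x -> is_derive x 1 (prim psi) (psi x)}.
Proof.
move=> ipsi; have lpsi : locally_integrable setT psi.
  by apply: open_integrable_locally => //; exact: openT.
have ipsi0 y : mu.-integrable `[0, y] (EFin \o psi) by exact: integrable_itv.
have := FTC1 ipsi0 lpsi; apply: ae_imply => x H x0.
have [dF DF] : derivable (prim psi) x 1 /\ (prim psi)^`()%classic x = psi x.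
  by apply: H; rewrite lte_fin.
by apply: DeriveDef; [exact: dF|rewrite -derive1E; exact: DF].
Qed.

(** Integrate [le_powR_affine] applied to [|psi x|]; the primitive of [|psi| ^ p] serves as [V]. *)
Lemma controlled_prim T p psi : 1 < p -> mu.-integrable setT (EFin \o psi) ->
  mu.-integrable setT (fun x => (`|psi x| `^ p)%:E) -> controlled T (prim psi).
Proof.
move=> p1 ipsi ippsi; exists (prim (fun x => `|psi x| `^ p)).
  move=> s t s0 st tT; rewrite -subr_ge0 primB//.
  by apply: Rintegral_ge0 => x _; exact: powR_ge0.
move=> e e0; have [C C0 eC] := le_powR_affine p1 e0.
exists C => // s t s0 st tT; rewrite (le_trans (norm_primB _ _ _))//.
rewrite primB//; last exact: integrable_norm.
have ist : mu.-integrable `]s, t] (EFin \o (fun x => `|psi x| `^ p)).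
  exact: integrable_itv.
have icst : mu.-integrable `]s, t] (EFin \o cst C).
  have mu_fin : (mu `]s, t] < +oo)%E.
    by rewrite lebesgue_measure_itv/=; case: ifP => _; rewrite ?ltry// -EFinD ltry.
  apply: (measurable_bounded_integrable _ mu_fin) => //.
  exists C; split; first exact: num_real.
  by move=> x Cx y _ /=; rewrite ger0_norm// ltW.
have iZ : mu.-integrable `]s, t] (EFin \o (fun x => e * `|psi x| `^ p)).
  exact: (integrableZl _ e ist).
apply: (@le_trans _ _ (\int[mu]_(x in `]s, t]) (e * `|psi x| `^ p + C))).
  apply: le_Rintegral => //.
  - by apply: integrable_itv; exact: integrable_norm.
  - exact: (integrableD _ iZ icst).
  - by move=> x _; exact: eC.
rewrite RintegralD//.
have mu_st : fine (mu `]s, t]) = t - s.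
  rewrite lebesgue_measure_itv/= lte_fin.
  by move: st; rewrite le_eqVlt => /predU1P[->|->//]; rewrite ltxx subrr.
by rewrite RintegralZl// -primB// lerD2l Rintegral_cst// [fine _]mu_st.
Qed.

(** Fundamental theorem of calculus: [q - prim psi] and its opposite are controlled with a.e.
    derivative zero, so both are nondecreasing by [controlled_le]. *)
Lemma controlled_prim_eq T p q psi : 1 < p -> controlled T q ->
  mu.-integrable setT (EFin \o psi) ->
  mu.-integrable setT (fun x => (`|psi x| `^ p)%:E) ->
  {ae mu, forall x : R, x \in `]0, T[ -> is_derive x 1 q (psi x)} ->
  forall s t, 0 <= s -> s <= t -> t <= T ->
  q t - q s = prim psi t - prim psi s.
Proof.
move=> p1 cq ipsi ippsi dq s t s0 st tT.
have cP := controlled_prim T p1 ipsi ippsi.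
have dP := prim_is_derive ipsi.
have {}st0 x : x \in `]s, t[ -> 0 < x /\ x \in `]0, T[.
  rewrite !in_itv/= => /andP[sx xt]; have x0 := le_lt_trans s0 sx.
  by rewrite x0; split => //; exact: lt_le_trans tT.
have h1 : (q \+ \- prim psi) s <= (q \+ \- prim psi) t.
  apply: controlled_le s0 st tT _; first exact/controlledD/controlledN.
  move: dq dP; apply: ae_imply2 => x dqx dPx /st0[x0 xT]; exists 0 => //.
  rewrite -(subrr (psi x)); have := is_deriveB (dqx xT) (dPx x0).
  by apply.
have h2 : (prim psi \+ \- q) s <= (prim psi \+ \- q) t.
  apply: controlled_le s0 st tT _; first exact/controlledD/controlledN.
  move: dq dP; apply: ae_imply2 => x dqx dPx /st0[x0 xT]; exists 0 => //.
  rewrite -(subrr (psi x)); have := is_deriveB (dPx x0) (dqx xT).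
  by apply.
by move: h1 h2 => /=; lra.
Qed.

End Primitive.

Section LpFunctions.
Context (R : realType) (d : nat).
Variables (p T : R).
Hypothesis p1 : 1 < p.
Implicit Types (phi : R -> 'rV[R]_d) (h : R -> R).
Local Notation mu := (@lebesgue_measure R).

Lemma measurable_enorm phi (D : set R) : measurable D ->
  (forall i, measurable_fun D (fun t => phi t ord0 i)) ->
  measurable_fun D (fun t => enorm (phi t)).
Proof.
move=> mD mphi; apply: (@measurableT_comp _ _ _ _ _ _ (@Num.sqrt R)).
  by apply: continuous_measurable_fun; exact: sqrt_continuous.
apply: measurable_sum => i; apply: measurable_funX; exact: mphi.
Qed.

(** Integrability of [h] itself follows from that of its p-th power on a bounded interval, [|h|]
    being dominated there by [|h| ^ p + C]. *)
Lemma Lp_itv_integrable h : Lp_itv p T h ->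
  mu.-integrable setT (EFin \o (h \_ `[0, T])) /\
  mu.-integrable setT (fun x => (`|(h \_ `[0, T]) x| `^ p)%:E).
Proof.
rewrite /Lp_itv/= => hLp.
have ip := Lfun_integrable (ltW p1) hLp; split => //.
have mh : measurable_fun setT (h \_ `[0, T]).
  by move: hLp; rewrite inE => /andP[]; rewrite inE.
have [C C0 eC] := le_powR_affine p1 (@ltr01 R).
have ig : mu.-integrable setT
    (EFin \o (fun x => `|(h \_ `[0, T]) x| `^ p + C * \1_(`[0, T]%classic : set R) x)).
  have iC := integrableZl measurableT C (integrable_indic_itv 0 T true false).
  by have := integrableD measurableT ip iC.
apply: (le_integrable measurableT _ _ ig); first exact/measurable_EFinP.
move=> x _; rewrite /= lee_fin [leRHS]ger0_norm; last first.
  by rewrite addr_ge0 ?powR_ge0// mulr_ge0.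
rewrite indicE; have := eC `|(h \_ `[0, T]) x| (normr_ge0 _); rewrite mul1r.
rewrite patchE; case: ifPn => // _; first by rewrite mulr1.
by move=> _; rewrite normr0 mulr0 addr0 powR_ge0.
Qed.

Lemma Lp_itv_vec_integrable phi i : Lp_itv_vec p T phi ->
  let psi := (fun t => phi t ord0 i) \_ `[0, T] in
  mu.-integrable setT (EFin \o psi) /\
  mu.-integrable setT (fun x => (`|psi x| `^ p)%:E).
Proof.
move=> [mphi /Lp_itv_integrable[i1 ip]] psi.
have mpsi : measurable_fun setT psi.
  by apply/(measurable_restrictT _ (measurable_itv _)); exact: mphi.
have le_psi x : `|psi x| <= `|((fun t => enorm (phi t)) \_ `[0, T]) x|.
  rewrite /psi !patchE; case: ifPn => _ //.
  by rewrite [leRHS]ger0_norm ?enorm_ge0// coord_le_enorm.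
split.
  apply: (le_integrable measurableT _ _ i1) => //; first exact/measurable_EFinP.
  by move=> x _; rewrite /= lee_fin.
apply: (le_integrable measurableT _ _ ip) => //.
  apply/measurable_EFinP; apply: (measurableT_comp (measurable_powR _)) => //.
  exact: measurableT_comp.
move=> x _; rewrite /= lee_fin !(ger0_norm (powR_ge0 _ _)) ge0_ler_powR//.
by rewrite (le_trans ler01)// ltW.
Qed.

Lemma Lp_itv_vec_dominated phi h :
  (forall i, measurable_fun `[0, T] (fun t => phi t ord0 i)) -> Lp_itv p T h ->
  {ae mu, forall t, t \in `[0, T] -> enorm (phi t) <= h t} -> Lp_itv_vec p T phi.
Proof.
move=> mphi hLp le_h; split => //.
have mn : measurable_fun setT ((fun t => enorm (phi t)) \_ `[0, T]).
  by apply/(measurable_restrictT _ (measurable_itv _)); exact: measurable_enorm.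
have [i1 ip] := Lp_itv_integrable hLp.
rewrite /Lp_itv/= inE; apply/andP; split; rewrite inE//=.
rewrite /finite_norm unlock /Lnorm poweR_lty//.
have := integrable_lty measurableT ip.
apply: le_lt_trans; apply: ae_ge0_le_integral => //.
- by move=> x _; rewrite lee_fin powR_ge0.
- apply/measurable_EFinP; apply: (measurableT_comp (measurable_powR _)) => //.
  exact: measurableT_comp.
- exact: measurable_int ip.
- move: le_h; apply: ae_imply => t ht _; rewrite lee_fin ge0_ler_powR ?nnegrE//.
    by rewrite (le_trans ler01)// ltW.
  rewrite !patchE; case: ifPn => // tT; rewrite inE/= in tT.
  by rewrite ger0_norm ?enorm_ge0// (le_trans (ht tT))// ler_norm.
Qed.

Lemma p_integrably_bounded_enorm (Phi : R -> set 'rV[R]_d) :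
  p_integrably_bounded p T Phi -> exists2 h, Lp_itv p T h &
    {ae mu, forall t, t \in `[0, T] -> forall a, Phi t a -> enorm a <= h t}.
Proof.
move=> [h hLp bnd]; exists h => //; move: bnd; apply: ae_imply => t bt tT a Pa.
rewrite -lee_fin; apply: le_trans (bt tT).
by apply: ereal_sup_ubound; exists a.
Qed.

End LpFunctions.
(** * Young integrals *)

Section Partitions.
Context (R : realType).
Implicit Types (a b x delta : R) (s : seq R).

Lemma mesh_cons a b x s : mesh a b (x :: s) = Num.max (x - a) (mesh x b s).
Proof. by rewrite /mesh /= big_nat_recl. Qed.

(** Properness says that partitions of arbitrarily small mesh exist, and it makes limits along the
    filter unique. They are built by steps of length [delta / 2], by induction on the number of
    steps that suffices to reach [b]. *)
Lemma mesh_to0_proper a b : a <= b -> ProperFilter (mesh_to0 a b).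
Proof.
move=> ab; apply: filter_from_proper; last first.
  move=> delta /= delta0.
  suff H n a' : a' <= b -> b - a' <= n%:R * (delta / 2) ->
      exists s, itv_partition a' b s /\ mesh a' b s < delta.
    have [n bn] : exists n, b - a <= n%:R * (delta / 2).
      have d2 : 0 < delta / 2 by rewrite divr_gt0.
      exists (Num.truncn ((b - a) / (delta / 2))).+1.
      by rewrite -ler_pdivrMr// ltW// truncnS_gt.
    by have [s] := H n a ab bn; exists s.
  elim: n a' => [|n ih] a' a'b bn.
    have -> : a' = b by apply/eqP; rewrite eq_le a'b -subr_le0 (le_trans bn)// mul0r.
    by exists [::]; split => //; rewrite /mesh big_nil.
  move: a'b; rewrite le_eqVlt => /predU1P[->|a'b].
    by exists [::]; split => //; rewrite /mesh big_nil.
  have [le2|gt2] := leP (b - a') (delta / 2).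
    exists [:: b]; split; first exact: itv_partition1.
    by rewrite mesh_cons /mesh big_nil gt_max delta0 andbT; lra.
  have a'2 : a' + delta / 2 <= b by lra.
  have [|s [ps ms]] := ih _ a'2.
    by move: bn; rewrite -[n.+1]addn1 natrD mulrDl mul1r; lra.
  exists (a' + delta / 2 :: s); split.
    case: ps => ps ls; split => //=; rewrite ps andbT ltrDl; lra.
  by rewrite mesh_cons gt_max ms andbT; lra.
apply: filter_from_filter; first by exists 1 => /=.
move=> d1 d2 /= d10 d20; exists (Num.min d1 d2); first by rewrite /= lt_min d10.
by move=> s /= [ps]; rewrite lt_min => /andP[].
Qed.

End Partitions.

Section YoungIntegrals.
Context (R : realType).
Local Notation mu := (@lebesgue_measure R).
Variables (T alpha M : R) (g : R -> R).
Hypotheses (T0 : 0 < T) (alpha0 : 0 < alpha) (M0 : 0 <= M).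
Hypothesis gM : forall s t, 0 <= s -> s <= t -> t <= T ->
  `|g t - g s| <= M * (t - s) `^ alpha.

Lemma holder_osc s t x y : 0 <= s -> s <= x -> x <= t -> s <= y -> y <= t -> t <= T ->
  `|g x - g y| <= M * (t - s) `^ alpha.
Proof.
have half x' y' : 0 <= s -> s <= x' -> y' <= t -> t <= T -> x' <= y' ->
    `|g y' - g x'| <= M * (t - s) `^ alpha.
  move=> s0 sx yt tT xy; apply: (le_trans (gM _ xy _)).
  - exact: le_trans sx.
  - exact: le_trans tT.
  - by rewrite ler_wpM2l// ge0_ler_powR ?(ltW alpha0)// ?nnegrE; lra.
move=> s0 sx xt sy yt tT; have [xy|/ltW yx] := leP x y.
  by rewrite distrC half.
exact: half.
Qed.

Lemma holder_continuous : {within `[0, T], continuous g}.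
Proof.
apply/subspace_continuousP => x; rewrite /= in_itv/= => /andP[x0 xT].
apply/cvgrPdist_le => e e0; pose c := e / (M + 1).
have c0 : 0 < c by rewrite divr_gt0// ltr_wpDl.
have d0 : 0 < c `^ alpha^-1 by exact: powR_gt0.
exists (c `^ alpha^-1) => // y /= xy; rewrite in_itv/= => /andP[y0 yT].
apply: (@le_trans _ _ (M * `|x - y| `^ alpha)).
  change (`|g x - g y| <= M * `|x - y| `^ alpha).
  have [yx|/ltW xy'] := leP y x; first by rewrite (@ger0_norm _ (x - y)) ?subr_ge0// gM.
  by rewrite distrC (distrC x) (@ger0_norm _ (y - x)) ?subr_ge0// gM.
apply: (@le_trans _ _ (M * c)).
  rewrite ler_wpM2l//; apply: (@le_trans _ _ ((c `^ alpha^-1) `^ alpha)).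
    by rewrite ge0_ler_powR ?(ltW alpha0)// ?nnegrE// ltW.
  by rewrite -powRrM mulVf ?gt_eqF// powRr1// ltW.
by rewrite /c mulrCA -[leRHS]mulr1 ler_pM2l// ler_pdivrMr ?ltr_wpDl// mul1r lerDl.
Qed.

(** Cut off, [g] is bounded and measurable on the whole line, so that its product with an integrable
    function is integrable. *)
Let G := g \_ `[0, T].

Lemma integrable_holderM psi : mu.-integrable setT (EFin \o psi) ->
  mu.-integrable setT (EFin \o (fun x => psi x * G x)).
Proof.
move=> ipsi; have mG : measurable_fun setT G.
  apply/(measurable_restrictT _ (measurable_itv _)).
  by apply: subspace_continuous_measurable_fun => //; exact: holder_continuous.
have bG : [bounded G x | x in [set: R]].
  exists (`|g 0| + M * T `^ alpha); split; first exact: num_real.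
  move=> B HB x _; apply: ltW; apply: le_lt_trans HB.
  rewrite /G patchE; case: ifPn => [|_]; last first.
    by rewrite normr0 addr_ge0// mulr_ge0// powR_ge0.
  rewrite inE/= in_itv/= => /andP[x0 xT].
  rewrite -[g x](subrK (g 0)) addrC (le_trans (ler_normD _ _))// lerD2l.
  by rewrite -[X in X `^ _]subr0 holder_osc// ltW.
by have := integrableMl measurableT ipsi mG bG.
Qed.

Variables (f psi : R -> R).
Hypothesis ipsi : mu.-integrable setT (EFin \o psi).
Hypothesis fpsi : forall s t, 0 <= s -> s <= t -> t <= T ->
  f t - f s = prim psi t - prim psi s.

(* The Young integral of f against g on [a, b], after integration by parts. *)
Definition parts a b : R := f b * g b - f a * g a -
  (prim (fun x => psi x * G x) b - prim (fun x => psi x * G x) a).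

(** As [f b - f a] is the integral of [psi], the difference equals the integral of
    [psi x * (g x - g b)] over []a, b]]; only the oscillation of [g] enters. *)
Lemma parts_step a b w : 0 <= a -> a <= b -> b <= T ->
  (forall x, a <= x -> x <= b -> `|g x - g b| <= w) ->
  `|(g b - g a) * f a - parts a b| <=
  w * (prim (fun x => `|psi x|) b - prim (fun x => `|psi x|) a).
Proof.
move=> a0 ab bT gw; have iG := integrable_holderM ipsi.
have ab_sub (h : R -> R) : mu.-integrable setT (EFin \o h) ->
    mu.-integrable `]a, b] (EFin \o h) by exact: integrableS.
have -> : (g b - g a) * f a - parts a b =
    \int[mu]_(x in `]a, b]) (psi x * G x - g b * psi x).
  rewrite RintegralB//; [|exact: ab_sub|]; last first.
    by exact: (integrableZl _ (g b) (ab_sub _ ipsi)).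
  rewrite RintegralZl//; last exact: ab_sub.
  by rewrite -!primB// -(fpsi a0 ab bT) /parts; ring.
have iab : mu.-integrable `]a, b] (EFin \o (fun x => psi x * G x - g b * psi x)).
  have iZ : mu.-integrable `]a, b] (EFin \o (fun x => g b * psi x)).
    by exact: (integrableZl _ (g b) (ab_sub _ ipsi)).
  exact: (integrableB _ (ab_sub _ iG) iZ).
rewrite (le_trans (le_normr_Rintegral _ _))//.
have inpsi := integrable_norm ipsi.
rewrite primB// -RintegralZl//; last exact: ab_sub.
apply: le_Rintegral => //.
- exact: integrable_norm.
- by exact: (integrableZl _ w (ab_sub _ inpsi)).
- move=> x /=; rewrite in_itv/= => /andP[ax xb].
  rewrite /G patchE mem_set; last first.
    by rewrite /= in_itv/= (le_trans a0 (ltW ax)) (le_trans xb).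
  rewrite [g b * _]mulrC -mulrBr normrM mulrC ler_wpM2r// gw// ltW//.
Qed.

(** The errors of [parts_step] add up, because [parts] and the integral of [|psi|] are both additive
    over adjacent intervals. *)
Lemma riemann_parts a b s delta w : 0 <= a -> b <= T ->
  itv_partition a b s -> mesh a b s < delta ->
  (forall x y, 0 <= x -> x <= y -> y <= T -> y - x < delta -> `|g x - g y| <= w) ->
  `|partition_sum (fun x y => (g y - g x) * f x) b a s - parts a b| <=
  w * (prim (fun x => `|psi x|) b - prim (fun x => `|psi x|) a).
Proof.
move=> + bT + + gw; elim: s a => [a a0 /itv_partition_nil -> _|x s ih a a0 pxs].
  by rewrite partition_sum_nil /parts !subrr normr0 mulr0.
rewrite mesh_cons gt_max => /andP[xa ms].
have ax : a < x by case: pxs => /andP[].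
have ps : itv_partition x b s by exact: itv_partition_cons pxs.
have xb : x <= b by exact: itv_partition_le ps.
have x0 : 0 <= x by rewrite (le_trans a0)// ltW.
rewrite partition_sum_cons.
have -> : parts a b = parts a x + parts x b by rewrite /parts; ring.
rewrite opprD addrACA (le_trans (ler_normD _ _))//.
have -> : prim (fun x => `|psi x|) b - prim (fun x => `|psi x|) a =
    (prim (fun x => `|psi x|) x - prim (fun x => `|psi x|) a) +
    (prim (fun x => `|psi x|) b - prim (fun x => `|psi x|) x) by ring.
rewrite mulrDr lerD//; last exact: ih.
apply: parts_step => //; [exact: ltW|exact: le_trans bT|].
move=> y ay yx; apply: gw => //; [exact: le_trans ay|exact: le_trans bT|lra].
Qed.

Lemma parts_cvg a b : 0 <= a -> b <= T ->
  forall e, 0 < e -> exists2 delta, 0 < delta & forall s, itv_partition a b s ->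
  mesh a b s < delta ->
  `|partition_sum (fun x y => (g y - g x) * f x) b a s - parts a b| <= e.
Proof.
move=> a0 bT e e0; pose P := \int[mu]_x `|psi x|.
have P0 : 0 <= P by apply: Rintegral_ge0.
(* Chosen so that [M * c * P <= e]; a mesh below [c ^ (1 / alpha)] keeps the oscillation of [g] on
   each step at most [M * c]. *)
pose c := e / ((M + 1) * (P + 1)).
have c0 : 0 < c by rewrite divr_gt0// mulr_gt0// ltr_wpDl.
exists (c `^ alpha^-1); first exact: powR_gt0.
move=> s ps ms; have ab := itv_partition_le ps.
apply: (le_trans (riemann_parts (w := M * c) a0 bT ps ms _)).
  move=> x y x0 xy yT yx; apply: (le_trans (@holder_osc x y _ _ _ _ _ _ _ _)) => //.
  rewrite ler_wpM2l//.
  apply: (@le_trans _ _ ((c `^ alpha^-1) `^ alpha)).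
    by rewrite ge0_ler_powR ?(ltW alpha0)// ?nnegrE ?powR_ge0 ?subr_ge0// ltW.
  by rewrite -powRrM mulVf ?gt_eqF// powRr1// ltW.
apply: (@le_trans _ _ (M * c * P)).
  by rewrite ler_wpM2l ?prim_norm_le// mulr_ge0// ltW.
rewrite /c mulrAC mulrA ler_pdivrMr ?mulr_gt0 ?ltr_wpDl//.
rewrite mulrC ler_pM2l//; apply: ler_pM => //; exact: ler_wpDr.
Qed.

(** Compare with the one-step Riemann sum [(g t - g s) * f s], which differs from the integral by at
    most the oscillation of [g] times the integral of [|psi|]. *)
Lemma norm_parts s t B : 0 <= s -> s <= t -> t <= T -> `|f s| <= B ->
  `|parts s t| <= (B + \int[mu]_x `|psi x|) * (M * (t - s) `^ alpha).
Proof.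
move=> s0 st tT fB.
have w0 : 0 <= M * (t - s) `^ alpha by rewrite mulr_ge0// powR_ge0.
have H := @parts_step s t _ s0 st tT (fun x sx xt => holder_osc s0 sx xt st (lexx t) tT).
rewrite -[parts s t](subKr ((g t - g s) * f s)) (le_trans (ler_normB _ _))//.
rewrite [leRHS]mulrDl lerD//.
  by rewrite normrM mulrC ler_pM// gM.
rewrite (le_trans H)// mulrC ler_wpM2r// prim_norm_le//.
Qed.

Lemma partsB s t : parts 0 t - parts 0 s = parts s t.
Proof. by rewrite /parts; ring. Qed.

End YoungIntegrals.
(** * Selections with derivative in D_H F *)

Section VariationComparison.
Context (R : realType).
Variables (p T : R).
Hypotheses (p1 : 1 < p) (T0 : 0 < T).

Let p0 : 0 <= p. Proof. exact: le_trans ler01 (ltW p1). Qed.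

Lemma riesz_variation_dominated (E1 E2 : Type) (rho1 : E1 -> E1 -> R)
    (rho2 : E2 -> E2 -> R) f1 f2 :
  (forall s t, 0 <= s -> s < t -> t <= T ->
    0 <= rho1 (f1 s) (f1 t) <= rho2 (f2 s) (f2 t)) ->
  (riesz_variation rho2 p T f2 < +oo)%E -> (riesz_variation rho1 p T f1 < +oo)%E.
Proof.
move=> le12 /(riesz_variation_majorant T0)[V fV].
apply: (riesz_variation_lty (V := V)) => s t s0 st tT.
apply: le_trans (fV s t s0 st tT); rewrite ler_wpM2r ?invr_ge0 ?powR_ge0//.
have /andP[r0 r12] := le12 s t s0 st tT.
by rewrite ge0_ler_powR ?nnegrE//; exact: le_trans r12.
Qed.

(** Serves both [dot (f t) u] and [supp (F t) u], whose increments are at most [enorm u] times the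
    distance between the values. *)
Lemma controlled_variation (E : Type) (rho : E -> E -> R) f q c : 0 <= c ->
  (forall s t, 0 <= s -> s < t -> t <= T ->
    0 <= rho (f s) (f t) /\ `|q t - q s| <= c * rho (f s) (f t)) ->
  (riesz_variation rho p T f < +oo)%E -> controlled T q.
Proof.
move=> c0 qf /(riesz_variation_majorant T0)[V fV].
apply: (@controlled_riesz _ _ p _ (fun t => c `^ p * V t)) => // s t s0 st tT.
have [r0 qr] := qf s t s0 st tT.
apply: (@le_trans _ _ ((c * rho (f s) (f t)) `^ p / (t - s) `^ (p - 1))).
  rewrite ler_wpM2r ?invr_ge0 ?powR_ge0// ge0_ler_powR ?nnegrE ?mulr_ge0//.
rewrite powRM// -mulrA -mulrBr ler_wpM2l ?powR_ge0//; exact: fV.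
Qed.

Lemma powRD_le (a b : R) : 0 <= a -> 0 <= b ->
  (a + b) `^ p <= 2 `^ p * (a `^ p + b `^ p).
Proof.
move=> a0 b0.
wlog ab : a b a0 b0 / a <= b.
  move=> H; have [ab|/ltW ba] := leP a b; first exact: H.
  by rewrite addrC (addrC (a `^ p)); exact: H.
apply: (@le_trans _ _ ((2 * b) `^ p)).
  by rewrite ge0_ler_powR ?nnegrE ?addr_ge0 ?mulr_ge0// mulr_natl mulr2n lerD2r.
by rewrite powRM// ler_wpM2l ?powR_ge0// lerDr powR_ge0.
Qed.

End VariationComparison.

Section BoundedVariation.
Context (R : realType) (d : nat).
Variables (p T : R).
Hypotheses (p1 : 1 < p) (T0 : 0 < T).
Implicit Types (f : R -> 'rV[R]_d) (F : R -> set 'rV[R]_d).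

Lemma BVpD f1 f2 : BVp p T f1 -> BVp p T f2 -> BVp p T (f1 + f2).
Proof.
move=> /(riesz_variation_majorant T0)[V1 fV1] /(riesz_variation_majorant T0)[V2 fV2].
apply: (riesz_variation_lty (V := fun t => 2 `^ p * (V1 t + V2 t))) => s t s0 st tT.
have -> : 2 `^ p * (V1 t + V2 t) - 2 `^ p * (V1 s + V2 s) =
    2 `^ p * ((V1 t - V1 s) + (V2 t - V2 s)) by ring.
apply: le_trans (ler_wpM2l (powR_ge0 _ _)
  (lerD (fV1 s t s0 st tT) (fV2 s t s0 st tT))).
rewrite -mulrDl mulrA ler_wpM2r ?invr_ge0 ?powR_ge0//.
apply: (@le_trans _ _ ((enorm (f1 s - f1 t) + enorm (f2 s - f2 t)) `^ p)); last first.
  by apply: powRD_le => //; exact: enorm_ge0.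
rewrite ge0_ler_powR ?nnegrE ?addr_ge0 ?enorm_ge0//.
  exact: le_trans ler01 (ltW p1).
by rewrite /eucl_dist /= opprD addrACA enormD.
Qed.

Lemma BVp_controlled f u : BVp p T f -> controlled T (fun t => dot (f t) u).
Proof.
apply: (controlled_variation p1 T0 (enorm_ge0 u)) => s t _ _ _; split.
  exact: enorm_ge0.
by rewrite -dotBl mulrC /eucl_dist enormB norm_dot_le.
Qed.

Lemma supp_controlled F u : BVp_Conv p T F -> controlled T (fun t => supp (F t) u).
Proof.
move=> [cF]; apply: (controlled_variation p1 T0 (enorm_ge0 u)) => s t s0 st tT.
have cs : Conv (F s) by apply: cF; rewrite in_itv/=; apply/andP; split; lra.
have ct : Conv (F t) by apply: cF; rewrite in_itv/=; apply/andP; split; lra.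
by rewrite hausdorff_dist_ge0//; split => //; rewrite hausdorffC supp_hausdorff.
Qed.

Lemma is_derive_dot f (t : R) (v u : 'rV[R]_d) : is_derive t 1 f v ->
  is_derive t 1 (fun s => dot (f s) u) (dot v u).
Proof.
move=> [df Df].
have H : h^-1 *: (f (h *: 1 + t) - f t) @[h --> 0^'] --> v by rewrite -Df; exact: df.
suff H' : h^-1 *: (dot (f (h *: 1 + t)) u - dot (f t) u) @[h --> 0^'] --> dot v u.
  by apply: DeriveDef; [apply/cvg_ex; eexists; exact: H'|exact/cvg_lim].
rewrite (_ : (fun h => _) =
    (fun y : 'rV[R]_d => dot y u) \o (fun h : R => h^-1 *: (f (h *: 1 + t) - f t))).
  by apply: continuous_cvg H; exact: continuous_dot.
by apply/funext => h /=; rewrite dotZl dotBl.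
Qed.

Lemma controlled_cst c : controlled T (fun=> c).
Proof.
exists (fun=> 0) => // e e0; exists 0 => // s t _ _ _.
by rewrite !subrr normr0 mulr0 mul0r addr0.
Qed.

Lemma controlledZ q c : controlled T q -> controlled T (fun t => q t * c).
Proof.
move=> [V Vm Vq]; exists V => // e e0; pose k := `|c| + 1.
have k0 : 0 < k by rewrite ltr_wpDl.
have [C C0 qC] := Vq (e / k) (divr_gt0 e0 k0); exists (k * C).
  by rewrite mulr_ge0// ltW.
move=> s t s0 st tT; rewrite -mulrBl normrM mulrC.
apply: (@le_trans _ _ (k * `|q t - q s|)); first by rewrite ler_wpM2r// lerDl.
apply: le_trans (ler_wpM2l (ltW k0) (qC s t s0 st tT)) _.
by rewrite mulrDr [k * (e / k * _)]mulrA [k * (e / k)]mulrC divfK ?gt_eqF// mulrA.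
Qed.

Lemma controlled_sum (I : Type) (r : seq I) (q : I -> R -> R) :
  (forall i, controlled T (q i)) -> controlled T (fun t => \sum_(i <- r) q i t).
Proof.
move=> cq; elim: r => [|i r ih].
  by under eq_fun do rewrite big_nil; exact: controlled_cst.
by under eq_fun do rewrite big_cons; exact: controlledD.
Qed.

(* The slope of supp (F t) u - <f t, u> is nonnegative wherever f' lies in D_H F. *)
Lemma increment_supp F f u : BVp_Conv p T F -> hukuhara_differentiable T F ->
  controlled T (fun t => dot (f t) u) ->
  {ae (@lebesgue_measure R), forall t : R, t \in `]0, T[ ->
    exists2 v, is_derive t 1 f v & D_H T F t v} ->
  forall s t, 0 <= s -> s <= t -> t <= T ->
  dot (f t - f s) u <= supp (F t) u - supp (F s) u.
Proof.
move=> bF dF cf df s t s0 st tT.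
suff : ((fun t => supp (F t) u) \+ \- (fun t => dot (f t) u)) s <=
    ((fun t => supp (F t) u) \+ \- (fun t => dot (f t) u)) t.
  by rewrite /= dotBl; lra.
apply: (controlled_le _ s0 st tT).
  by apply: controlledD; [exact: supp_controlled|exact: controlledN].
move: df; apply: ae_imply => x H xst.
have xT : x \in `]0, T[.
  by move: xst; rewrite !in_itv/= => /andP[? ?]; apply/andP; split; lra.
have [v dv Dv] := H xT; exists (supp (D_H T F x) u - dot v u).
  rewrite subr_ge0 supp_ge//.
  have xT' : x \in `[0, T].
    by move: xT; rewrite !in_itv/= => /andP[? ?]; apply/andP; split; lra.
  by have [] := D_H_P dF xT'.
exact: is_deriveB (supp_is_derive u bF.1 dF xT) (is_derive_dot u dv).
Qed.

Lemma IS_intro F f phi : BVp_Conv p T F -> hukuhara_differentiable T F ->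
  (forall u, controlled T (fun t => dot (f t) u)) -> F 0 (f 0) ->
  Lp_itv_vec p T phi ->
  {ae (@lebesgue_measure R), forall t : R, t \in `]0, T[ -> D_H T F t (phi t)} ->
  {ae (@lebesgue_measure R), forall t : R, t \in `]0, T[ -> is_derive t 1 f (phi t)} ->
  IS p T F f.
Proof.
move=> bF dF cf F0 Lphi Dphi dphi.
have incr u := increment_supp bF dF (cf u) _.
have {}incr u s t : 0 <= s -> s <= t -> t <= T ->
    dot (f t - f s) u <= supp (F t) u - supp (F s) u.
  apply: incr; move: Dphi dphi; apply: ae_imply2 => x Dx dx xT.
  by exists (phi x); [exact: dx|exact: Dx].
have cF t : 0 <= t -> t <= T -> Conv (F t).
  by move=> t0 tT; apply: bF.1; rewrite in_itv/= t0.
split; last by exists phi; [split => //|]; exact: ae_itv_oo_cc.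
split.
  apply: (riesz_variation_dominated p1 T0 _ bF.2) => s t s0 st tT.
  rewrite enorm_ge0/=; set D := f s - f t.
  have cs : Conv (F s) by apply: cF => //; lra.
  have ct : Conv (F t) by apply: cF => //; lra.
  (* The increment of [f] is itself taken as direction [u]; dividing by its norm then leaves the
     Hausdorff distance. *)
  have : dot (f t - f s) (f t - f s) <= enorm D * hausdorff_dist (F s) (F t).
    apply: le_trans (incr _ _ _ s0 (ltW st) tT) _.
    by rewrite (le_trans (ler_norm _))// /D enormB hausdorffC supp_hausdorff.
  rewrite -sqr_enorm enormB -/D /eucl_dist -/D.
  have [->|D0] := eqVneq (enorm D) 0; first by rewrite hausdorff_dist_ge0.
  by rewrite expr2 ler_pM2l// lt_neqAle eq_sym D0 enorm_ge0.
move=> t; rewrite in_itv/= => /andP[t0 tT].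
apply: supp_separation; first exact: cF.
move=> u; have := incr u 0 t (lexx 0) t0 tT; rewrite dotBl.
have := supp_ge u (cF 0 (lexx 0) (ltW T0)) F0; lra.
Qed.

(** Pointwise limit of the difference quotients with steps [1 / (n + 1)]. The support function of
    [F] is cut off outside []0, T[] to be measurable on the whole line; for large [n] the shifted
    point is still inside, so the cut does not affect the limit. *)
Lemma measurable_supp_D_H F u : BVp_Conv p T F -> hukuhara_differentiable T F ->
  measurable_fun (`]0, T[%classic : set R) (fun t => supp (D_H T F t) u).
Proof.
move=> bF dF; pose q t := supp (F t) u.
pose q0 : R -> R := q \_ `]0, T[.
have mq : measurable_fun setT q0.
  apply/(measurable_restrictT _ (measurable_itv _)).
  apply: open_continuous_measurable_fun; first exact: itv_open.
  move=> t; rewrite inE => tT; apply: differentiable_continuous.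
  by apply/derivable1_diffP; case: (supp_is_derive u bF.1 dF tT).
apply: (@measurable_fun_cvg _ _ R _ (fun (n : nat) (t : R) =>
    n.+1%:R * (q0 (t + n.+1%:R^-1) - q0 t) : R)).
  move=> n; apply: measurable_funTS; apply: measurable_funM; first exact: measurable_cst.
  apply: measurable_funB => //; apply: (measurableT_comp mq).
  by apply: measurable_funD => //; exact: measurable_cst.
move=> t /= tT; have /andP[t0 tT'] : 0 < t < T by move: tT; rewrite in_itv.
have tT2 : t \in `[0, T] by rewrite in_itv/= !ltW.
have := hukuhara_derivative_right (u := u) bF.1 (D_H_P dF tT2) (ltW t0) tT'.
move=> /cvg_at_rightP/(_ (fun n => n.+1%:R^-1)).
have inv_cvg : (fun n => n.+1%:R^-1) @ \oo --> (0 : R) by exact: cvg_harmonic.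
move=> /(_ (conj (fun n => _) inv_cvg)) H.
have {}H := H (fun n => _); apply: cvg_trans (H _); last by move=> n; rewrite invr_gt0.
have tT3 : 0 < T - t by rewrite subr_gt0.
apply: near_eq_cvg; near=> n; rewrite invrK /=; congr (_ * (_ - _)).
  rewrite /q0 patchE mem_set//= in_itv/=; apply/andP; split.
    by rewrite addr_gt0// invr_gt0.
  rewrite -ltrBrDl; near: n; exact: (near_infty_natSinv_lt (PosNum tT3)).
by rewrite /q0 patchE mem_set.
Unshelve. all: by end_near. Qed.

End BoundedVariation.

(** * Splitting the selections of a Minkowski sum *)

Section Decomposition.
Context (R : realType) (d : nat).
Variables (p T : R).
Hypotheses (p1 : 1 < p) (T0 : 0 < T).
Implicit Types (f phi : R -> 'rV[R]_d) (F : R -> set 'rV[R]_d).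
Local Notation mu := (@lebesgue_measure R).

Lemma is_derive_row f (t : R) (v : 'rV[R]_d) :
  (forall i, is_derive t 1 (fun s => f s ord0 i) (v ord0 i)) -> is_derive t 1 f v.
Proof.
move=> dfi; have df : derivable f t 1.
  by apply/derivable_mxP => i j; rewrite ord1; case: (dfi j).
apply: DeriveDef => //; rewrite derive_mx//; apply/rowP => j; rewrite mxE.
by case: (dfi j).
Qed.

Lemma is_derive_coord f (t : R) (v : 'rV[R]_d) i :
  is_derive t 1 f v -> is_derive t 1 (fun s => f s ord0 i) (v ord0 i).
Proof.
move=> df; rewrite -dot_delta (_ : (fun s => _) = fun s => dot (f s) (delta_mx ord0 i)).
  exact: is_derive_dot.
by apply/funext => s; rewrite dot_delta.
Qed.

(** Membership in a compact convex set is thus a countable family of linear inequalities, the form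
    of constraint that [measurable_selection] accepts. *)
Lemma supp_separation_dense (A : set 'rV[R]_d) x (q : nat -> 'rV[R]_d) :
  (forall x e, 0 < e -> exists k, enorm (x - q k) < e) -> Conv A ->
  (forall k, dot x (q k) <= supp A (q k)) -> A x.
Proof.
move=> dq cA xA; apply: supp_separation => // u; apply/ler_addgt0Pr => e e0.
have [M M0 AM] := Conv_bounded cA.
pose c := e / (M + enorm x + 1).
have M1 : 0 < M + enorm x + 1 by rewrite ltr_wpDl// addr_ge0// enorm_ge0.
have c0 : 0 < c by rewrite divr_gt0.
have [k kc] := dq u c c0.
have -> : dot x u = dot x (q k) + dot x (u - q k) by rewrite -dotDr addrC subrK.
have : supp A (u + (q k - u)) <= supp A u + M * enorm (q k - u) by exact: supp_leD.
rewrite addrC subrK enormB => H.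
have : M * enorm (u - q k) <= M * c by rewrite ler_wpM2l// ltW.
have : dot x (u - q k) <= enorm x * c.
  by apply: le_trans (dot_le _ _) _; rewrite ler_wpM2l ?enorm_ge0// ltW.
have : M * c + enorm x * c <= e.
  rewrite -mulrDl /c mulrA ler_pdivrMr// mulrC ler_wpM2l ?(ltW e0)//.
  by rewrite lerDl.
have := xA k; lra.
Qed.

Lemma Lp_itv_vec_D_H F phi : p_integrably_bounded p T (D_H T F) ->
  (forall i, measurable_fun (`[0, T]%classic : set R) (fun t => phi t ord0 i)) ->
  {ae mu, forall t : R, t \in `]0, T[ -> D_H T F t (phi t)} ->
  Lp_itv_vec p T phi.
Proof.
move=> /p_integrably_bounded_enorm[h hLp bnd] mphi /ae_itv_oo_cc Dphi.
apply: (Lp_itv_vec_dominated p1 mphi hLp).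
by move: bnd Dphi; apply: ae_imply2 => t b D tT; apply: b => //; exact: D.
Qed.

Lemma Lp_itvD h1 h2 : Lp_itv p T h1 -> Lp_itv p T h2 -> Lp_itv p T (h1 \+ h2).
Proof.
rewrite /Lp_itv/= => H1 H2; have p1' : (1 <= p%:E)%E by rewrite lee_fin ltW.
rewrite (_ : _ \_ _ = h1 \_ `[0, T] + h2 \_ `[0, T]).
  exact: (Lfun_addr_closed mu p1').2.
apply/funext => x; rewrite [RHS]/GRing.add/= !patchE.
by case: ifP => //; rewrite addr0.
Qed.

Lemma row_prim_controlled (a u : 'rV[R]_d) (psi : 'I_d -> R -> R) :
  (forall i, mu.-integrable setT (EFin \o psi i) /\
    mu.-integrable setT (fun x => (`|psi i x| `^ p)%:E)) ->
  controlled T (fun t => dot (a + \row_i prim (psi i) t) u).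
Proof.
move=> psiL; apply: controlled_sum => i; apply: controlledZ.
have -> : (fun t => (a + \row_j prim (psi j) t) ord0 i) =
    (fun=> a ord0 i) \+ prim (psi i) by apply/funext => t; rewrite !mxE.
apply: controlledD; first exact: controlled_cst.
exact: controlled_prim p1 (psiL i).1 (psiL i).2.
Qed.

Lemma row_prim_is_derive (a : 'rV[R]_d) (psi : 'I_d -> R -> R) :
  (forall i, mu.-integrable setT (EFin \o psi i)) ->
  {ae mu, forall t : R, 0 < t ->
    is_derive t 1 (fun t => a + \row_i prim (psi i) t) (\row_i psi i t)}.
Proof.
move=> ipsi; have := ae_forall (fun i => prim_is_derive (ipsi i)).
apply: ae_imply => t H t0; apply: is_derive_row => i; rewrite mxE.
have -> : (fun s => (a + \row_j prim (psi j) s) ord0 i) = cst (a ord0 i) + prim (psi i).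
  by apply/funext => s; rewrite !mxE.
rewrite -[psi i t]add0r; apply: is_deriveD; exact: H.
Qed.

Lemma measurable_split F1 F2 phi : BVp_Conv p T F1 -> BVp_Conv p T F2 ->
  hukuhara_differentiable T F1 -> hukuhara_differentiable T F2 ->
  (forall i, measurable_fun (`[0, T]%classic : set R) (fun t => phi t ord0 i)) ->
  {ae mu, forall t : R, t \in `[0, T] ->
    minkowski_sum (D_H T F1 t) (D_H T F2 t) (phi t)} ->
  exists phi1 : R -> 'rV[R]_d,
    [/\ forall i, measurable_fun setT (fun t => phi1 t ord0 i),
    {ae mu, forall t : R, t \in `]0, T[ -> D_H T F1 t (phi1 t)} &
    {ae mu, forall t : R, t \in `]0, T[ -> D_H T F2 t (phi t - phi1 t)}].
Proof.
move=> bF1 bF2 dF1 dF2 mphi [N [mN N0 phiN]].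
have [q dq] := dense_sequence R d.
(* Off the measurable null set [N] the decomposition exists at every point, as
   [measurable_selection] requires of its domain. *)
pose E : set R := `]0, T[ `\` N.
have mE : measurable E by apply: measurableD => //; exact: measurable_itv.
have E0T t : E t -> t \in `]0, T[ by case.
have EcT t : E t -> t \in `[0, T].
  by move/E0T; rewrite !in_itv/= => /andP[? ?]; rewrite !ltW.
have Esum t : E t -> minkowski_sum (D_H T F1 t) (D_H T F2 t) (phi t).
  move=> Et; have tT := EcT t Et; case: Et => _ Nt.
  by apply: contrapT => H; apply: Nt; apply: phiN => /= /(_ tT).
(* Even indices express that [a] lies in [D_H T F1 t]. Odd ones express that [phi t - a] lies in
   [D_H T F2 t], an inequality rewritten as a bound on [dot a (- q)]. *)
pose u k : 'rV[R]_d := if odd k then - q k./2 else q k./2.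
pose c k t := if odd k then supp (D_H T F2 t) (q k./2) - dot (phi t) (q k./2)
  else supp (D_H T F1 t) (q k./2).
have mS F v : BVp_Conv p T F -> hukuhara_differentiable T F ->
    measurable_fun E (fun t => supp (D_H T F t) v).
  move=> bF dF; have := measurable_supp_D_H v bF dF.
  by apply: measurable_funS => // t [].
have mc k : measurable_fun E (c k).
  rewrite /c; case: (odd k); last exact: mS.
  apply: measurable_funB; first exact: mS.
  apply: measurable_sum => i; apply: measurable_funM; last exact: measurable_cst.
  by apply: measurable_funS (mphi i) => // t /EcT.
have [t Et|psi mpsi psiE] := measurable_selection mE mc (u := u).
  have [a Da [b Db ab]] := Esum t Et; exists a => k; rewrite /u /c.
  have [cD1 _ _] := D_H_P dF1 (EcT t Et); have [cD2 _ _] := D_H_P dF2 (EcT t Et).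
  case: (odd k); last exact: supp_ge.
  rewrite -ab dotDl dotNr; have := supp_ge (q k./2) cD2 Db; lra.
have aeE (P : R -> Prop) : (forall t, E t -> P t) ->
    {ae mu, forall t : R, t \in `]0, T[ -> P t}.
  move=> EP; exists N; split => // t /= H; apply: contrapT => Nt; apply: H => tT.
  by apply: EP.
pose phi1 t := if t \in E then psi t else 0.
exists phi1; split.
- move=> i; have -> : (fun t => phi1 t ord0 i) = (fun t => psi t ord0 i) \_ E.
    by apply/funext => t; rewrite /phi1 patchE; case: ifP => //; rewrite mxE.
  by apply/(measurable_restrictT _ mE).
- apply: aeE => t Et; rewrite /phi1 mem_set//.
  apply: (supp_separation_dense dq).
    by have [] := D_H_P dF1 (EcT t Et).
  by move=> k; have := psiE t Et k.*2; rewrite /u /c odd_double doubleK.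
- apply: aeE => t Et; rewrite /phi1 mem_set//.
  apply: (supp_separation_dense dq).
    by have [] := D_H_P dF2 (EcT t Et).
  move=> k; have := psiE t Et k.*2.+1.
  by rewrite /u /c /= odd_double/= uphalf_double dotNr dotBl; lra.
Qed.

(* For f in IS (F1 + F2), split f' into selections of D_H F1 and D_H F2; then f1 is
   a primitive of the first and f2 = f - f1. *)
Lemma IS_minkowski F1 F2 : BVp_Conv p T F1 -> BVp_Conv p T F2 ->
  hukuhara_differentiable T F1 -> hukuhara_differentiable T F2 ->
  p_integrably_bounded p T (D_H T F1) -> p_integrably_bounded p T (D_H T F2) ->
  IS p T (fun t => minkowski_sum (F1 t) (F2 t)) =
  [set f1 + f2 | f1 in IS p T F1 & f2 in IS p T F2].
Proof.
move=> bF1 bF2 dF1 dF2 iF1 iF2.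
have DS t : t \in `[0, T] -> D_H T (fun t => minkowski_sum (F1 t) (F2 t)) t =
    minkowski_sum (D_H T F1 t) (D_H T F2 t).
  by move=> tT; apply: D_H_minkowski => //; [exact: bF1.1|exact: bF2.1].
have T00 : (0 : R) \in `[0, T] by rewrite in_itv/= lexx ltW.
apply/seteqP; split => [f [[bf fF] [phi [Lphi Dphi] dphi]]|].
  have {}Dphi : {ae mu, forall t : R, t \in `[0, T] ->
      minkowski_sum (D_H T F1 t) (D_H T F2 t) (phi t)}.
    by move: Dphi; apply: ae_imply => t H tT; rewrite -DS//; exact: H.
  have [phi1 [mphi1 D1 D2]] := measurable_split bF1 bF2 dF1 dF2 Lphi.1 Dphi.
  have L1 : Lp_itv_vec p T phi1.
    apply: Lp_itv_vec_D_H iF1 _ D1 => i; exact: measurable_funTS.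
  have L2 : Lp_itv_vec p T (phi \- phi1).
    apply: Lp_itv_vec_D_H iF2 _ D2 => i.
    have -> : (fun t => (phi \- phi1) t ord0 i) = (fun t => phi t ord0 i - phi1 t ord0 i).
      by apply/funext => t; rewrite !mxE.
    by apply: measurable_funB; [exact: Lphi.1|exact: measurable_funTS].
  have [a1 Fa1 [a2 Fa2 a12]] := fF 0 T00.
  pose psi i := (fun t => phi1 t ord0 i) \_ `[0, T].
  have psiL i := Lp_itv_vec_integrable p1 i L1.
  (* Starting [f1] at [a1] makes [f - f1] start at [a2], so both summands satisfy the initial
     condition of [IS_intro]. *)
  pose f1 t := a1 + \row_i prim (psi i) t.
  have prim0 h : prim h 0 = 0 :> R by rewrite /prim set_itv1 Rintegral_set1.
  have f10 : f1 0 = a1.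
    by rewrite /f1; apply/rowP => i; rewrite !mxE prim0 addr0.
  have cf1 u : controlled T (fun t => dot (f1 t) u).
    exact: row_prim_controlled.
  have df1 : {ae mu, forall t : R, t \in `]0, T[ -> is_derive t 1 f1 (phi1 t)}.
    have := row_prim_is_derive a1 (fun i => (psiL i).1); apply: ae_imply => t H tT.
    have -> : phi1 t = \row_i psi i t.
      apply/rowP => i; rewrite mxE /psi patchE mem_set//=.
      by move: tT; rewrite !in_itv/= => /andP[? ?]; rewrite !ltW.
    by apply: H; move: tT; rewrite in_itv/= => /andP[].
  have IS1 : IS p T F1 f1.
    by apply: IS_intro L1 D1 df1 => //; rewrite f10.
  exists f1 => //; exists (f - f1); last by rewrite addrC subrK.
  apply: IS_intro L2 D2 _ => //.
  - move=> u; have -> : (fun t => dot ((f - f1) t) u) =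
        (fun t => dot (f t) u) \+ \- (fun t => dot (f1 t) u).
      by apply/funext => t; rewrite /= dotBl.
    by apply: controlledD; [exact: BVp_controlled bf|exact: controlledN].
  - by change (F2 0 (f 0 - f1 0)); rewrite f10 -a12 addrC addKr.
  - move: (ae_itv_cc_oo dphi) df1; apply: ae_imply2 => t H1 H2 tT.
    by apply: is_deriveB; [exact: H1|exact: H2].
move=> _ [f1 [[b1 f1F] [phi1 [L1 D1] d1]] [f2 [[b2 f2F] [phi2 [L2 D2] d2]] <-]].
split.
  split; first exact: BVpD.
  by move=> t tT; exists (f1 t); [exact: f1F|exists (f2 t) => //; exact: f2F].
exists (phi1 \+ phi2); last first.
  move: d1 d2; apply: ae_imply2 => t H1 H2 tT.
  by apply: is_deriveD; [exact: H1|exact: H2].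
have m12 i : measurable_fun (`[0, T]%classic : set R) (fun t => (phi1 \+ phi2) t ord0 i).
  have -> : (fun t => (phi1 \+ phi2) t ord0 i) = (fun t => phi1 t ord0 i + phi2 t ord0 i).
    by apply/funext => t; rewrite !mxE.
  by apply: measurable_funD; [exact: L1.1|exact: L2.1].
split; last first.
  move: D1 D2; apply: ae_imply2 => t H1 H2 tT; rewrite DS//.
  by exists (phi1 t); [exact: H1|exists (phi2 t) => //; exact: H2].
have [h1 Lh1 B1] := p_integrably_bounded_enorm iF1.
have [h2 Lh2 B2] := p_integrably_bounded_enorm iF2.
apply: (Lp_itv_vec_dominated p1 (h := h1 \+ h2)) => //; first exact: Lp_itvD.
have H1 := ae_imply2 (fun t (a : t \in `[0, T] -> _) b tT => a tT _ (b tT)) B1 D1.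
have H2 := ae_imply2 (fun t (a : t \in `[0, T] -> _) b tT => a tT _ (b tT)) B2 D2.
move: H1 H2; apply: ae_imply2 => t H1 H2 tT.
by apply: le_trans (enormD _ _) _; rewrite lerD ?H1 ?H2.
Qed.

End Decomposition.

(** * Young integrals of the selections, with uniform bounds *)

Section YoungIntegralOfSelections.
Context (R : realType) (d : nat).
Variables (p T alpha M : R) (g : R -> R).
Hypotheses (p1 : 1 < p) (T0 : 0 < T) (alpha0 : 0 < alpha) (M0 : 0 <= M).
Hypothesis gM : forall s t, 0 <= s -> s <= t -> t <= T ->
  `|g t - g s| <= M * (t - s) `^ alpha.
Implicit Types (f : R -> 'rV[R]_d) (F : R -> set 'rV[R]_d).
Local Notation mu := (@lebesgue_measure R).

Lemma riemann_sum_coord f a b s i : riemann_sum f g a b s ord0 i =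
  partition_sum (fun x y => (g y - g x) * f x ord0 i) b a s.
Proof.
by rewrite /riemann_sum summxE; apply: eq_bigr => n _; rewrite mxE.
Qed.

Lemma norm_le_coords (x : 'rV[R]_d) e : 0 <= e ->
  (forall i, `|x ord0 i| <= e) -> `|x| <= e.
Proof.
move=> e0 xe; rewrite {1}/Num.norm /= mx_normrE; apply/bigmax_leP.
by split => // -[i j] _ /=; rewrite ord1.
Qed.

Lemma riemann_sum_cvg f (psi : 'I_d -> R -> R) a b :
  (forall i, mu.-integrable setT (EFin \o psi i)) ->
  (forall i s t, 0 <= s -> s <= t -> t <= T ->
    f t ord0 i - f s ord0 i = prim (psi i) t - prim (psi i) s) ->
  0 <= a -> a <= b -> b <= T ->
  riemann_sum f g a b @ mesh_to0 a b -->
    (\row_i parts T g (fun t => f t ord0 i) (psi i) a b : 'rV[R]_d).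
Proof.
move=> ipsi fpsi a0 ab bT; have PF := mesh_to0_proper ab.
apply/cvgrPdist_le => e e0.
have H i : \forall s \near mesh_to0 a b,
    `|partition_sum (fun x y => (g y - g x) * f x ord0 i) b a s -
      parts T g (fun t => f t ord0 i) (psi i) a b| <= e.
  have [delta delta0 Hd] := parts_cvg T0 alpha0 M0 gM (ipsi i) (fpsi i) a0 bT e0.
  by exists delta => // s [ps ms]; exact: Hd.
have := filter_forall (mesh_to0_proper ab : Filter _) H; apply: filterS => s Hs.
by apply: norm_le_coords (ltW e0) _ => i; rewrite !mxE riemann_sum_coord distrC.
Qed.

(** [C] is the integral of a function dominating all elements of [D_H T F], hence common to all the
    selections [f]. *)
Lemma IS_primitive F : p_integrably_bounded p T (D_H T F) ->
  exists2 C, 0 <= C & forall f, IS p T F f -> exists psi : 'I_d -> R -> R,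
    forall i, [/\ mu.-integrable setT (EFin \o psi i),
      forall s t, 0 <= s -> s <= t -> t <= T ->
        f t ord0 i - f s ord0 i = prim (psi i) t - prim (psi i) s &
      \int[mu]_x `|psi i x| <= C].
Proof.
move=> /p_integrably_bounded_enorm[h hLp bnd].
have [ih _] := Lp_itv_integrable p1 hLp.
exists (\int[mu]_x `|(h \_ `[0, T]) x|); first exact: Rintegral_ge0.
move=> f [[bf _] [phi [Lphi Dphi] dphi]].
exists (fun i => (fun t => phi t ord0 i) \_ `[0, T]) => i.
have [ipsi ippsi] := Lp_itv_vec_integrable p1 i Lphi; split => //.
  apply: (controlled_prim_eq p1 _ ipsi ippsi).
    rewrite (_ : (fun t => _) = fun t => dot (f t) (delta_mx ord0 i)).
      exact: (BVp_controlled p1 T0 _ bf).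
    by apply/funext => t; rewrite dot_delta.
  move: dphi; apply: ae_imply => t H; rewrite in_itv/= => /andP[t0 tT].
  have tcc : t \in `[0, T] by rewrite in_itv/= !ltW.
  rewrite patchE mem_set//; apply: (is_derive_coord i); exact: H.
have inpsi := integrable_norm ipsi; have inh := integrable_norm ih.
apply: fine_le; [exact: integrable_fin_num inpsi|exact: integrable_fin_num inh|].
apply: ae_ge0_le_integral => //.
- exact: measurable_int inpsi.
- exact: measurable_int inh.
- move: bnd Dphi; apply: ae_imply2 => t b D _; rewrite lee_fin !patchE.
  case: ifPn => // tT; rewrite inE/= in tT.
  apply: le_trans (coord_le_enorm _ _) _; apply: le_trans (ler_norm _).
  by apply: b => //; exact: D.
Qed.

Lemma young_integralD f1 f2 a b : a <= b ->
  cvg (riemann_sum f1 g a b @ mesh_to0 a b) ->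
  cvg (riemann_sum f2 g a b @ mesh_to0 a b) ->
  young_integral (f1 + f2) g a b = young_integral f1 g a b + young_integral f2 g a b.
Proof.
move=> ab c1 c2; have PF := mesh_to0_proper ab.
apply: cvg_lim; first exact: norm_hausdorff.
rewrite (_ : riemann_sum (f1 + f2) g a b =
    riemann_sum f1 g a b \+ riemann_sum f2 g a b).
  exact: cvgD.
apply/funext => s; rewrite /riemann_sum /= -big_split; apply: eq_bigr => n _ /=.
by rewrite -scalerDr.
Qed.

Lemma IS_young F : Conv (F 0) -> p_integrably_bounded p T (D_H T F) ->
  exists2 C, 0 <= C & forall f, IS p T F f -> forall s t, 0 <= s -> s <= t -> t <= T ->
    [/\ cvg (riemann_sum f g s t @ mesh_to0 s t),
    enorm (young_integral f g s t) <= C * (t - s) `^ alpha &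
    young_integral f g 0 t - young_integral f g 0 s = young_integral f g s t].
Proof.
move=> cF0 /IS_primitive[C C0 FC]; have [B B0 FB] := Conv_bounded cF0.
(* [B] bounds [F 0], hence [f 0]; one [C] bounds the increment of a coordinate from 0 to [s], the
   other the integral of [|psi i|] in [norm_parts]; [d] comes from summing the coordinates. *)
exists (d%:R * ((B + C + C) * M)).
  by rewrite mulr_ge0// mulr_ge0// !addr_ge0.
move=> f ISf; have [psi psiP] := FC f ISf.
have ipsi i : mu.-integrable setT (EFin \o psi i) by have [] := psiP i.
have fpsi i s t : 0 <= s -> s <= t -> t <= T ->
    f t ord0 i - f s ord0 i = prim (psi i) t - prim (psi i) s.
  by have [_ H _] := psiP i; exact: H.
have youngE s t : 0 <= s -> s <= t -> t <= T -> young_integral f g s t =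
    \row_i parts T g (fun t => f t ord0 i) (psi i) s t.
  move=> s0 st tT; have PF := mesh_to0_proper st.
  by apply: cvg_lim; [exact: norm_hausdorff|exact: riemann_sum_cvg].
move=> s t s0 st tT; split.
- apply/cvg_ex; eexists; exact: riemann_sum_cvg ipsi fpsi s0 st tT.
- rewrite youngE// (le_trans (enorm_le_sum _))//.
  rewrite -mulrA -[X in X%:R]card_ord mulr_natl -sumr_const ler_sum// => i _.
  rewrite mxE -mulrA; have [_ _ psiC] := psiP i.
  have fB : `|f s ord0 i| <= B + C.
    have F0 : F 0 (f 0) by case: ISf => -[_ fF] _; apply: fF; rewrite in_itv/= lexx ltW.
    have sT : s <= T by exact: le_trans tT.
    rewrite -[f s ord0 i](subrK (f 0 ord0 i)) addrC (le_trans (ler_normD _ _))// lerD//.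
      exact: le_trans (coord_le_enorm _ _) (FB _ F0).
    rewrite fpsi// (le_trans (norm_primB _ _ _))//.
    exact: le_trans (prim_norm_le (ipsi i) (lexx 0) s0) psiC.
  apply: le_trans (norm_parts T0 alpha0 M0 gM (ipsi i) (fpsi i) s0 st tT fB) _.
  by rewrite ler_wpM2r ?lerD2l// mulr_ge0// powR_ge0.
- have sT := le_trans st tT; have t0 := le_trans s0 st; rewrite !youngE//.
  by apply/rowP => i; rewrite !mxE partsB.
Qed.

End YoungIntegralOfSelections.

(** * Closures of bounded sets and their sums *)

Section Closure.
Context (R : realType) (d : nat).
Implicit Types (A B : set 'rV[R]_d).

Lemma closure_enorm_le A M : (forall x, A x -> enorm x <= M) ->
  forall x, closure A x -> enorm x <= M.
Proof.
move=> AM; have cM : closed [set x : 'rV[R]_d | enorm x <= M].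
  rewrite (_ : [set x | _] = (@enorm R d) @^-1` [set y | y <= M])//.
  by apply: closed_comp; [move=> x _; exact: continuous_enorm|exact: closed_le].
move=> x; have := closure_subset AM; rewrite -((closure_id _).1 cM); exact.
Qed.

Lemma enorm_bounded_set A M : (forall x, A x -> enorm x <= M) -> bounded_set A.
Proof.
move=> AM; exists M; split; first exact: num_real.
move=> N MN x Ax; apply: le_trans (norm_le_enorm x) _.
exact: le_trans (AM x Ax) (ltW MN).
Qed.

(** Boundedness makes the two closures compact, so their sum is compact and hence closed; the other
    inclusion is continuity of addition. *)
Lemma closure_minkowski A B M N : (forall x, A x -> enorm x <= M) ->
  (forall x, B x -> enorm x <= N) ->
  closure (minkowski_sum A B) = minkowski_sum (closure A) (closure B).
Proof.
move=> AM BN.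
have sumE (C D : set 'rV[R]_d) : minkowski_sum C D =
    (fun z : 'rV[R]_d * 'rV[R]_d => z.1 + z.2) @` (C `*` D).
  apply/seteqP; split=> [_ [u Cu [v Dv <-]]|_ [[u v] /= [Cu Dv] <-]].
    by exists (u, v).
  by exists u => //; exists v.
apply/seteqP; split.
  have cpt (C : set 'rV[R]_d) K : (forall x, C x -> enorm x <= K) -> compact (closure C).
    move=> CK; apply: bounded_closed_compact; last exact: closed_closure.
    exact: enorm_bounded_set (closure_enorm_le CK).
  have closed_sum : closed (minkowski_sum (closure A) (closure B)).
    apply: compact_closed; first exact: norm_hausdorff.
    rewrite sumE; apply: continuous_compact.
      by apply: continuous_subspaceT => z; exact: add_continuous.
    by apply: compact_setX; [exact: cpt AM|exact: cpt BN].
  rewrite ((closure_id _).1 closed_sum); apply: closure_subset.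
  move=> _ [x Ax [y By <-]]; exists x; first exact: subset_closure.
  by exists y => //; exact: subset_closure.
move=> _ [x clx [y cly <-]] U.
have cxy : (fun z : 'rV[R]_d * 'rV[R]_d => z.1 + z.2) @ (x, y) --> x + y.
  by apply: cvgD; [exact: cvg_fst|exact: cvg_snd].
move=> /cxy [[V W] /= [Vx Wy] VW].
have [a [Aa Va]] := clx V Vx; have [b [Bb Wb]] := cly W Wy.
by exists (a + b); split; [exists a => //; exists b|exact: (VW (a, b))].
Qed.

End Closure.

(** * Additivity and boundedness of the set-valued integral *)

Lemma holder_norm_lty (R : realType) (alpha T : R) (g : R -> R) : 0 < T ->
  (holder_norm Num.norm alpha T g < +oo)%E ->
  exists2 M, 0 <= M & forall s t, 0 <= s -> s <= t -> t <= T ->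
    `|g t - g s| <= M * (t - s) `^ alpha.
Proof.
move=> T0; rewrite /holder_norm; set S1 := ereal_sup _; set S2 := ereal_sup _ => S12.
(* Once both suprema are nonnegative, finiteness of their sum passes to [S2]; the pair [(0, T)]
   shows that [S2] is not a supremum over the empty set. *)
have S10 : (0 <= S1)%E.
  apply: le_trans (ereal_sup_ubound _); last by exists 0 => //=; rewrite in_itv/= lexx ltW.
  by rewrite lee_fin.
have S20 : (0 <= S2)%E.
  apply: (@le_trans _ _ (`|g T - g 0| / (T - 0) `^ alpha)%:E).
    by rewrite lee_fin divr_ge0// powR_ge0.
  by apply: ereal_sup_ubound; exists (0, T) => //=; split => //; apply/andP.
have S2fin : S2 \is a fin_num.
  by rewrite ge0_fin_numE//; apply: le_lt_trans S12; rewrite leeDr.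
exists (fine S2); first exact: fine_ge0.
move=> s t s0; rewrite le_eqVlt => /predU1P[->|st] tT.
  by rewrite !subrr normr0 mulr_ge0 ?powR_ge0// fine_ge0.
rewrite -ler_pdivrMr ?powR_gt0 ?subr_gt0// -lee_fin fineK//.
by apply: ereal_sup_ubound; exists (s, t) => //=; rewrite s0 st.
Qed.

Theorem theorem7 (R : realType) (d : nat) (T p alpha : R)
    (F F1 F2 : R -> set 'rV[R]_d) (g : R -> R) :
  (1 <= d)%N -> 0 < T -> 1 < p ->
  BVp_Conv p T F -> BVp_Conv p T F1 -> BVp_Conv p T F2 ->
  hukuhara_differentiable T F -> hukuhara_differentiable T F1 ->
  hukuhara_differentiable T F2 ->
  p_integrably_bounded p T (D_H T F) -> p_integrably_bounded p T (D_H T F1) ->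
  p_integrably_bounded p T (D_H T F2) ->
  0 < alpha <= 1 -> 1 < 1 / p + alpha ->
  (holder_norm Num.norm alpha T g < +oo)%E ->
  (forall t, t \in `[0, T] ->
    IS_integral p T (fun u => minkowski_sum (F1 u) (F2 u)) g 0 t =
    minkowski_sum (IS_integral p T F1 g 0 t) (IS_integral p T F2 g 0 t)) /\
  (bounded_set (F 0) ->
    holder_bounded (@enorm R d) alpha T (IS_integral_fun p T F g) /\
    (forall s t, 0 <= s -> s <= t -> t <= T ->
      bounded_set (IS_integral p T F g s t))).
Proof.
move=> _ T0 p1 bF bF1 bF2 dF dF1 dF2 iF iF1 iF2 /andP[alpha0 _] _ gH.
have [M M0 gM] := holder_norm_lty T0 gH.
have T00 : (0 : R) \in `[0, T] by rewrite in_itv/= lexx ltW.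
have [C C0 FC] := IS_young p1 T0 alpha0 M0 gM (bF.1 0 T00) iF.
have [C1 _ FC1] := IS_young p1 T0 alpha0 M0 gM (bF1.1 0 T00) iF1.
have [C2 _ FC2] := IS_young p1 T0 alpha0 M0 gM (bF2.1 0 T00) iF2.
split.
  move=> t; rewrite in_itv/= => /andP[t0 tT]; rewrite /IS_integral.
  (* The two bounds are those of [IS_young] on [[0, t]]; under them it remains to compare the sets
     before closure. *)
  rewrite -(@closure_minkowski _ _ _ _ (C1 * (t - 0) `^ alpha) (C2 * (t - 0) `^ alpha)).
  - congr closure; rewrite IS_minkowski//; apply/seteqP; split.
      move=> _ [_ [f1 S1 [f2 S2 <-]] <-].
      exists (young_integral f1 g 0 t); first by exists f1.
      exists (young_integral f2 g 0 t); first by exists f2.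
      have [c1 _ _] := FC1 f1 S1 0 t (lexx 0) t0 tT.
      have [c2 _ _] := FC2 f2 S2 0 t (lexx 0) t0 tT.
      exact/esym/(young_integralD t0 c1 c2).
    move=> _ [_ [f1 S1 <-] [_ [f2 S2 <-] <-]].
    exists (f1 + f2); first by exists f1 => //; exists f2.
    have [c1 _ _] := FC1 f1 S1 0 t (lexx 0) t0 tT.
    have [c2 _ _] := FC2 f2 S2 0 t (lexx 0) t0 tT.
    exact: young_integralD t0 c1 c2.
  - by move=> _ [f1 S1 <-]; have [] := FC1 f1 S1 0 t (lexx 0) t0 tT.
  - by move=> _ [f2 S2 <-]; have [] := FC2 f2 S2 0 t (lexx 0) t0 tT.
move=> _; split.
  (* One summand for each half of the norm: the integral from 0 is at most [C * T ^ alpha], and its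
     increment from [s] to [t] is the integral over [[s, t]], at most [C * (t - s) ^ alpha]. *)
  exists (C * T `^ alpha + C) => _ [f Sf <-]; rewrite /holder_norm EFinD leeD//.
    apply: ge_ereal_sup => _ [t + <-]; rewrite /= in_itv/= => /andP[t0 tT].
    have [_ H _] := FC f Sf 0 t (lexx 0) t0 tT.
    rewrite lee_fin (le_trans H)// ler_wpM2l// subr0.
    by rewrite ge0_ler_powR ?(ltW alpha0)// ?nnegrE// ltW.
  apply: ge_ereal_sup => _ [[s t] /= [/andP[s0 st] tT] <-].
  have [_ H E] := FC f Sf s t s0 (ltW st) tT.
  by rewrite lee_fin E ler_pdivrMr// powR_gt0// subr_gt0.
move=> s t s0 st tT.
apply: (@enorm_bounded_set _ _ _ (C * (t - s) `^ alpha)).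
by apply: closure_enorm_le => _ [f Sf <-]; have [] := FC f Sf s t s0 st tT.
Qed.
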